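(* Let $\varepsilon>0$ and $F\in(1,\infty)$ be fixed. There are no exponents $p,q,r\in(2,\infty)$ and constant $C>0$ such that the estimate $$\left\Vert e^{\pm\frac1\varepsilon itp_F(D)}g\right\Vert_{L^p_tL^q_x}\le C\Vert g\Vert_{L^r_x}$$ holds for all $g\in L^r(\mathbb{R}^3)$.
   Context: For $\xi=(\xi_1,\xi_2,\xi_3)\in\mathbb{R}^3$ let $|\xi|_F=|(\xi_1,\xi_2,F\xi_3)|$ and $p_F(\xi)=\dfrac{|\xi|_F}{F|\xi|}$. The operator $e^{\pm\frac1\varepsilon itp_F(D)}$ is defined by $$e^{\pm \frac1\varepsilon itp_F(D)}g:(t,x)\longmapsto\int_{\mathbb{R}^3}e^{ix\cdot\xi\pm\frac1\varepsilon itp_F(\xi)}\hat g(\xi)\,d\xi$$ for Schwartz $g$, and extended by density to general $g$, with $\hat g(\xi)=\int_{\mathbb{R}^3} e^{-ix\cdot\xi}g(x)\,dx$. The norm $\Vert u\Vert_{L^p_tL^q_x}$ is that of $L^p(\mathbb{R},L^q(\mathbb{R}^3))$ (time ranges over all of $\mathbb{R}$). *)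

(* Defs.v *)
From HB Require Import structures.
From mathcomp Require Import all_boot all_order all_algebra.
From mathcomp Require Import complex.
From mathcomp Require Import all_classical all_reals all_analysis.

Set Implicit Arguments.
Unset Strict Implicit.
Unset Printing Implicit Defensive.

Import Order.TTheory GRing.Theory Num.Theory.
Import numFieldNormedType.Exports.

Local Open Scope classical_set_scope.
Local Open Scope ring_scope.
Local Open Scope complex_scope.

(* R^3 is (R * R) * R, so xi = ((xi1, xi2), xi3). Functions are defined on
   R * R * R; measurability refers to the convertible product of copies of
   measurableTypeR R, the type on which lebesgue_measure is declared. *)
Local Notation R3 R := (Real.sort R * Real.sort R * Real.sort R)%type.
Local Notation mR2 R := (measurableTypeR R * measurableTypeR R)%type.
Local Notation mR3 R :=
  (measurableTypeR R * measurableTypeR R * measurableTypeR R)%type.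

(* all_analysis does not infer sigma-finiteness of a product measure, because
   the instance for products of subprobabilities shadows it. *)
Lemma sigma_finite_product d1 d2 (T1 : measurableType d1)
    (T2 : measurableType d2) (R : realType)
    (m1 : {sigma_finite_measure set T1 -> \bar R})
    (m2 : {sigma_finite_measure set T2 -> \bar R}) :
  sigma_finite setT (m1 \x m2)%E.
Proof.
have /sigma_finiteP[F [TF ndF Foo]] := sigma_finiteT m1.
have /sigma_finiteP[G [TG ndG Goo]] := sigma_finiteT m2.
exists (fun n => F n `*` G n).
  rewrite -setXTT TF TG predeqE => -[x y]; split.
    move=> [/= [n _ Fnx] [k _ Gky]]; exists (maxn n k) => //; split.
    - by move: x Fnx; exact/subsetPset/ndF/leq_maxl.
    - by move: y Gky; exact/subsetPset/ndG/leq_maxr.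
  by move=> [n _ []/= ? ?]; split; exists n.
move=> k; have [? ?] := Foo k; have [? ?] := Goo k.
split; first exact: measurableX.
by rewrite product_measure1E// lte_mul_pinfty// ge0_fin_numE.
Qed.

Definition leb2 {R : realType} : set (mR2 R) -> \bar R :=
  (lebesgue_measure \x lebesgue_measure)%E.

HB.instance Definition _ (R : realType) := Measure.on (@leb2 R).
HB.instance Definition _ (R : realType) :=
  Measure_isSigmaFinite.Build _ _ _ (@leb2 R)
    (sigma_finite_product lebesgue_measure lebesgue_measure).

Definition leb3 {R : realType} : set (mR3 R) -> \bar R :=
  (leb2 \x lebesgue_measure)%E.

HB.instance Definition _ (R : realType) := Measure.on (@leb3 R).
HB.instance Definition _ (R : realType) :=
  Measure_isSigmaFinite.Build _ _ _ (@leb3 R)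
    (sigma_finite_product leb2 lebesgue_measure).

Section Propagator.
Context {R : realType}.
Implicit Types (x xi : R3 R) (f : R3 R -> R) (g h : R3 R -> R[i]).

Definition dot3 x xi : R := x.1.1 * xi.1.1 + x.1.2 * xi.1.2 + x.2 * xi.2.

(* The norm instance of the library on R * R * R is the max norm. *)
Definition enorm3 x : R := Num.sqrt (dot3 x x).

Definition expi (a : R) : R[i] := cos a +i* sin a.

Definition cintegral3 g : R[i] :=
  (\int[leb3]_x complex.Re (g x)) +i* (\int[leb3]_x complex.Im (g x)).

Definition fourier3 g xi : R[i] :=
  cintegral3 (fun x => expi (- dot3 x xi) * g x).

(* p_F; it takes the irrelevant value 0 at the origin, where 0^-1 = 0. *)
Definition phaseF (F : R) xi : R :=
  enorm3 (xi.1.1, xi.1.2, F * xi.2) / (F * enorm3 xi).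

(* The formula defining e^{+ i t p_F(D) / eps} g (b = false) and
   e^{- i t p_F(D) / eps} g (b = true); the inverse transform carries no
   factor (2 pi)^-3. *)
Definition propagator (b : bool) (eps F : R) g (t : R) x : R[i] :=
  cintegral3 (fun xi =>
    expi (dot3 x xi + (-1) ^+ b * (eps^-1 * t * phaseF F xi)) *
    fourier3 g xi).

Definition basis3 (i : 'I_3) : R3 R :=
  ((i == 0%N :> nat)%:R, (i == 1%N :> nat)%:R, (i == 2%N :> nat)%:R).

Definition iter_partial (s : seq 'I_3) f : R3 R -> R :=
  foldr (fun i (k : R3 R -> R) => fun x => 'D_(basis3 i) k x) f s.

Definition schwartz_real f : Prop :=
  (forall s x, differentiable (iter_partial s f) x) /\
  (forall s (k : nat), exists M : R, forall x,
     enorm3 x ^+ k * `|iter_partial s f x| <= M).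

Definition schwartz g : Prop :=
  schwartz_real (fun x => complex.Re (g x)) /\
  schwartz_real (fun x => complex.Im (g x)).

Definition Lnorm3 (r : R) g : \bar R :=
  Lnorm leb3 r%:E (fun x => (Normc.normc (g x))%:E).

Definition in_Lp3 (r : R) g : Prop :=
  [/\ measurable_fun [set: mR3 R] (fun x : R3 R => complex.Re (g x)),
      measurable_fun [set: mR3 R] (fun x : R3 R => complex.Im (g x)) &
      (Lnorm3 r g < +oo)%E].

Definition mixed_Lnorm (p q : R) (u : R -> R3 R -> R[i]) : \bar R :=
  Lnorm lebesgue_measure p%:E (fun t : R => Lnorm3 q (u t)).

(* u is the value at g of the extension by density of the propagator to L^r:
   at each time, the L^r limit of the propagator along Schwartz functions that
   converge to g in L^r. For 1 < r < oo, such a limit exists and is unique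
   almost everywhere: phaseF is smooth away from 0 and homogeneous of degree 0,
   so at each time the propagator is a Mikhlin multiplier, bounded on L^r. *)
Definition is_propagation (b : bool) (eps F r : R) g
    (u : R -> R3 R -> R[i]) : Prop :=
  [/\ measurable_fun [set: measurableTypeR R * mR3 R]
        (fun z : R * R3 R => complex.Re (u z.1 z.2)),
      measurable_fun [set: measurableTypeR R * mR3 R]
        (fun z : R * R3 R => complex.Im (u z.1 z.2)) &
      exists G : nat -> R3 R -> R[i],
        [/\ forall n, schwartz (G n),
            Lnorm3 r (fun x => G n x - g x) @[n --> \oo] --> 0%E &
            forall t, Lnorm3 r (fun x =>
              propagator b eps F (G n) t x - u t x) @[n --> \oo] --> 0%E]].

Definition strichartz_estimate (b : bool) (eps F p q r C : R) : Prop :=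
  forall g, in_Lp3 r g -> forall u, is_propagation b eps F r g u ->
    (mixed_Lnorm p q u <= C%:E * Lnorm3 r g)%E.

End Propagator.

(* Main.v *)
Require Import Defs.
From HB Require Import structures.
From mathcomp Require Import all_boot all_order all_algebra.
From mathcomp Require Import complex ring lra.
From mathcomp Require Import all_classical all_reals all_analysis.
From mathcomp Require Import measurable_realfun.

Set Implicit Arguments.
Unset Strict Implicit.
Unset Printing Implicit Defensive.

Import Order.TTheory GRing.Theory Num.Theory.
Import numFieldNormedType.Exports.

Local Open Scope classical_set_scope.
Local Open Scope ring_scope.

Local Notation mR2 R := (measurableTypeR R * measurableTypeR R)%type.
Local Notation mR3 R :=
  (measurableTypeR R * measurableTypeR R * measurableTypeR R)%type.

(** The estimate fails because the symbol p_F is homogeneous of degree 0 and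
    equals 1 on the xi3-axis. Data whose Fourier transform concentrates in a
    thin cone around that axis hardly disperse over a prescribed time interval
    [0, T]: up to a constant and the unimodular factor e^{+- i t / eps} the
    evolution reproduces the initial datum, so its L^p_t L^q_x norm grows like
    T^{1/p}.

    Anisotropic Gaussians make this quantitative. For eta > 0 let
      g(x) = exp (- eta^2 (x1^2 + x2^2) - eta^{-4} x3^2).
    The product of the three coefficients is 1, hence every Lebesgue norm of g
    is independent of eta ([Lnorm3_squeeze]). The Fourier transform of g is an
    explicit positive Gaussian ([fourier3_gauss3]) of total mass (2 pi)^3, in
    which xi1 and xi2 have size eta while xi3 has size eta^{-2}. On its bulk
      0 <= 1 - p_F(xi) <= xi1^2 + xi2^2
    as soon as |xi3| >= 1 ([onem_phaseF_le]), and the slab |xi3| < 1 carries a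
    mass O(eta^2). Estimating cos y from below by 1 - y^2 / 2 in
      Re (e^{-+ i t / eps} u(t, x))
        = int cos (x . xi +- (t / eps) (p_F(xi) - 1)) ghat(xi) dxi
    gives |u(t, x)| >= (2 pi)^3 / 2 for t in [0, T] and for x in a box of sides
    comparable to 1 / eta, 1 / eta, eta^2, as soon as eta is small with respect
    to eps / T ([normc_propagator_gauss3_ge]). The volume of that box does not
    depend on eta either, so the mixed norm of u is at least a constant times
    T^{1/p} ([mixed_Lnorm_squeeze_ge]) while the norm of g stays fixed, and T
    is arbitrary.

    The test functions being Schwartz ([schwartz_gauss3]), the constant
    sequence g shows that t |-> propagator g t is the evolution of g. Since the
    family g is normalized in all Lebesgue spaces simultaneously, the argument
    is the same for q = r and q <> r. *)

(** * Integrability and product measures *)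

Lemma RintegrableZl (R : realType) d (T : measurableType d)
    (mu : {measure set T -> \bar R}) (k : R) (f : T -> R) :
  mu.-integrable setT (EFin \o f) ->
  mu.-integrable setT (EFin \o (fun x => k * f x)).
Proof.
move=> /(integrableZl measurableT k); exact: eq_integrable.
Qed.

Lemma RintegrableD (R : realType) d (T : measurableType d)
    (mu : {measure set T -> \bar R}) (f g : T -> R) :
  mu.-integrable setT (EFin \o f) -> mu.-integrable setT (EFin \o g) ->
  mu.-integrable setT (EFin \o (fun x => f x + g x)).
Proof. by move=> intf intg; exact: eq_integrable (integrableD _ intf intg). Qed.

Lemma RintegrableB (R : realType) d (T : measurableType d)
    (mu : {measure set T -> \bar R}) (f g : T -> R) :
  mu.-integrable setT (EFin \o f) -> mu.-integrable setT (EFin \o g) ->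
  mu.-integrable setT (EFin \o (fun x => f x - g x)).
Proof. by move=> intf intg; exact: eq_integrable (integrableB _ intf intg). Qed.

Lemma le_Rintegrable (R : realType) d (T : measurableType d)
    (mu : {measure set T -> \bar R}) (f g : T -> R) : measurable_fun setT f ->
  (forall x, `|f x| <= g x) -> mu.-integrable setT (EFin \o g) ->
  mu.-integrable setT (EFin \o f).
Proof.
move=> mf fg ig; apply: le_integrable ig => //.
  exact/measurable_EFinP.
by move=> x _ /=; rewrite lee_fin (le_trans (fg x))// ler_norm.
Qed.

Lemma measurable_cos (R : realType) : measurable_fun setT (@cos R).
Proof. exact: continuous_measurable_fun (@continuous_cos R). Qed.

Lemma measurable_sin (R : realType) : measurable_fun setT (@sin R).
Proof. exact: continuous_measurable_fun (@continuous_sin R). Qed.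

Section ProductIntegrals.
Context {R : realType} d1 d2 (T1 : measurableType d1) (T2 : measurableType d2).
Variables (m1 : {sigma_finite_measure set T1 -> \bar R})
          (m2 : {sigma_finite_measure set T2 -> \bar R}).

Lemma integrable_prodM (f1 : T1 -> R) (f2 : T2 -> R) :
  m1.-integrable setT (EFin \o f1) -> m2.-integrable setT (EFin \o f2) ->
  (m1 \x m2)%E.-integrable setT (fun z => (f1 z.1 * f2 z.2)%:E).
Proof.
move=> i1 i2.
have mf1 : measurable_fun setT f1.
  by apply/measurable_EFinP; exact: measurable_int i1.
have mf2 : measurable_fun setT f2.
  by apply/measurable_EFinP; exact: measurable_int i2.
apply/integrable12ltyP => /=.
  apply/measurable_EFinP/measurable_funM.
    exact: (measurableT_comp mf1 measurable_fst).
  exact: (measurableT_comp mf2 measurable_snd).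
under eq_integral.
  move=> x _.
  under eq_integral do rewrite normrM EFinM.
  rewrite ge0_integralZl//; last first.
    by apply/measurable_EFinP; exact: measurableT_comp.
  over.
rewrite ge0_integralZr//.
- move/integrableP : i1 => [_ i1]; move/integrableP : i2 => [_ i2].
  apply: lte_mul_pinfty => //; first exact: integral_ge0.
  by rewrite ge0_fin_numE//; exact: integral_ge0.
- by apply/measurable_EFinP; exact: measurableT_comp.
- exact: integral_ge0.
Qed.

Lemma Rintegral_prodM (f1 : T1 -> R) (f2 : T2 -> R) :
  m1.-integrable setT (EFin \o f1) -> m2.-integrable setT (EFin \o f2) ->
  \int[(m1 \x m2)%E]_z (f1 z.1 * f2 z.2) =
  (\int[m1]_x f1 x) * (\int[m2]_x f2 x).
Proof.
move=> i1 i2; rewrite /Rintegral -integral12_prod_meas1; last first.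
  exact: integrable_prodM.
rewrite /fubini_F/=.
under eq_integral.
  move=> x _.
  under eq_integral do rewrite EFinM.
  rewrite integralZl//.
  rewrite -(fineK (integrable_fin_num _ i2))//.
  over.
by rewrite integralZr// fineM//; exact: integrable_fin_num.
Qed.

(** Tonelli applies to the positive and to the negative part separately, and
    [fine] is measurable. *)
Lemma measurable_Rintegral_param (f : T1 * T2 -> R) : measurable_fun setT f ->
  measurable_fun setT (fun x => \int[m2]_y f (x, y)).
Proof.
move=> mf; rewrite /Rintegral; apply: measurableT_comp => //.
have -> : (fun x => \int[m2]_y (f (x, y))%:E)%E =
    ((fun x => \int[m2]_y (EFin \o f)^\+ (x, y)) \-
     (fun x => \int[m2]_y (EFin \o f)^\- (x, y)))%E.
  apply/funext => x; rewrite /= integralE.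
  have := funepos_comp (EFin \o f) (pair x).
  have := funeneg_comp (EFin \o f) (pair x).
  by rewrite /comp => -> ->.
apply: emeasurable_funB.
  apply: (measurable_fun_fubini_tonelli_F ((EFin \o f)^\+)%E) => //.
  by apply: measurable_funepos; exact/measurable_EFinP.
apply: (measurable_fun_fubini_tonelli_F ((EFin \o f)^\-)%E) => //.
by apply: measurable_funeneg; exact/measurable_EFinP.
Qed.

End ProductIntegrals.

Lemma Rintegral_fubini (R : realType) d1 d2 (T1 : measurableType d1)
    (T2 : measurableType d2) (m1 : {sigma_finite_measure set T1 -> \bar R})
    (m2 : {sigma_finite_measure set T2 -> \bar R}) (f : T1 * T2 -> R) :
  (m1 \x m2)%E.-integrable setT (EFin \o f) ->
  (forall x, m2.-integrable setT (EFin \o (fun y => f (x, y)))) ->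
  \int[(m1 \x m2)%E]_z f z = \int[m1]_x (\int[m2]_y f (x, y)).
Proof.
move=> intf intfx; rewrite /Rintegral -integral12_prod_meas1//.
congr fine; apply: eq_integral => x _; rewrite /fubini_F/=.
by rewrite fineK//; exact: integrable_fin_num (intfx x).
Qed.

(** * Gaussian integrals on the line *)

Section Gaussian1D.
Context {R : realType}.
Notation mu := (@lebesgue_measure R).
Implicit Types a x y th : R.

Definition gauss a x : R := expR (- (a * x ^+ 2)).

Lemma gauss_ge0 a x : 0 <= gauss a x. Proof. exact: expR_ge0. Qed.

Lemma gaussN a x : gauss a (- x) = gauss a x.
Proof. by rewrite /gauss sqrrN. Qed.

Lemma continuous_gauss a : continuous (gauss a).
Proof.
move=> x; apply: (@continuous_comp _ _ _ (fun x => - (a * x ^+ 2)) expR).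
  apply: cvgN; apply: cvgMr; exact: exprn_continuous.
exact: continuous_expR.
Qed.

Lemma measurable_gauss a : measurable_fun setT (gauss a).
Proof. by apply: continuous_measurable_fun; exact: continuous_gauss. Qed.

Lemma integral_gauss a : 0 < a ->
  (\int[mu]_x (gauss a x)%:E = (Num.sqrt (pi / a))%:E)%E.
Proof.
(* [gauss a] is a multiple of the centred normal density of variance
   1 / (2 a). *)
move=> a0; pose s := Num.sqrt ((2 * a)^-1).
have s2 : s ^+ 2 = (2 * a)^-1 by rewrite sqr_sqrtr// invr_ge0 mulr_ge0// ltW.
have s0 : s != 0 by rewrite gt_eqF// sqrtr_gt0 invr_gt0 mulr_gt0.
have pk : normal_peak s = (Num.sqrt (pi / a))^-1.
  rewrite /normal_peak s2; congr (Num.sqrt _)^-1; field; exact: lt0r_neq0.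
have sq0 : 0 < Num.sqrt (pi / a) by rewrite sqrtr_gt0 divr_gt0// pi_gt0.
under eq_integral => x _.
  rewrite (_ : gauss a x = Num.sqrt (pi / a) * normal_pdf 0 s x); last first.
    rewrite normal_pdfE// pk mulrA divff ?lt0r_neq0// mul1r.
    rewrite /normal_fun /gauss s2 subr0; congr expR; field; exact: lt0r_neq0.
  rewrite EFinM; over.
rewrite integralZl//; last exact: integrable_normal_pdf.
by rewrite integral_normal_pdf mule1.
Qed.

Lemma integrable_gauss a : 0 < a -> mu.-integrable setT (EFin \o gauss a).
Proof.
move=> a0; apply/integrableP; split.
  by apply/measurable_EFinP; exact: measurable_gauss.
under eq_integral do rewrite /= ger0_norm ?gauss_ge0//.
by rewrite integral_gauss// ltry.
Qed.

Lemma Rintegral_gauss a : 0 < a -> \int[mu]_x gauss a x = Num.sqrt (pi / a).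
Proof. by move=> a0; rewrite /Rintegral integral_gauss. Qed.

(** Half of the exponent absorbs the factor x^2, since y <= exp y at
    y = a x^2 / 2. *)
Lemma sqr_gauss_le a x : 0 < a ->
  x ^+ 2 * gauss a x <= 2 / a * gauss (a / 2) x.
Proof.
move=> a0.
have -> : gauss a x = gauss (a / 2) x * gauss (a / 2) x.
  by rewrite /gauss -expRD; congr expR; field.
rewrite mulrA ler_pM2r ?expR_gt0//.
have h : a / 2 * x ^+ 2 <= expR (a / 2 * x ^+ 2).
  by have := expR_ge1Dx (a / 2 * x ^+ 2); lra.
rewrite /gauss expRN ler_pdivrMr ?expR_gt0//.
rewrite -ler_pdivrMl ?divr_gt0//.
by rewrite invf_div.
Qed.

Lemma measurable_sqr_gauss a :
  measurable_fun setT (fun x : measurableTypeR R => x ^+ 2 * gauss a x).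
Proof.
by apply: measurable_funM; [exact: measurable_funX|exact: measurable_gauss].
Qed.

Lemma integrable_sqr_gauss a : 0 < a ->
  mu.-integrable setT (EFin \o (fun x => x ^+ 2 * gauss a x)).
Proof.
move=> a0; apply: (@le_Rintegrable _ _ _ mu _ (fun x => 2 / a * gauss (a / 2) x)).
- exact: measurable_sqr_gauss.
- move=> x; by rewrite ger0_norm ?sqr_gauss_le// mulr_ge0 ?sqr_ge0 ?gauss_ge0.
- by apply: RintegrableZl; apply: integrable_gauss; rewrite divr_gt0.
Qed.

Lemma Rintegral_sqr_gauss_le a : 0 < a ->
  \int[mu]_x (x ^+ 2 * gauss a x) <= 2 / a * Num.sqrt (2 * pi / a).
Proof.
move=> a0; have a20 : 0 < a / 2 by rewrite divr_gt0.
have -> : 2 * pi / a = pi / (a / 2) by field; exact: lt0r_neq0.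
rewrite -Rintegral_gauss// -RintegralZl//; last exact: integrable_gauss.
apply: le_Rintegral => //; first exact: integrable_sqr_gauss.
- by apply: RintegrableZl; exact: integrable_gauss.
- by move=> x _; exact: sqr_gauss_le.
Qed.

End Gaussian1D.

(** * Fourier transform of Gaussians *)

Section TotalDerivative.
Context {R : realType}.
Notation mu := (@lebesgue_measure R).

(** The integral over [-n, n] telescopes to boundary terms, which vanish in the
    limit; dominated convergence exhausts the line. *)
Lemma Rintegral_derivative (F f : R -> R) :
  continuous f -> (forall x : R, is_derive x 1 F (f x)) ->
  mu.-integrable setT (EFin \o f) ->
  F n.+1%:R @[n --> \oo] --> 0 -> F (- n.+1%:R) @[n --> \oo] --> 0 ->
  \int[mu]_x f x = 0.
Proof.
move=> cf dF intf Fy FNy.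
have mf : measurable_fun setT f by exact: continuous_measurable_fun.
pose I n : set R := `[- n.+1%:R, n.+1%:R]%classic.
have FTC n : (\int[mu]_(x in I n) (f x)%:E = (F n.+1%:R - F (- n.+1%:R))%:E)%E.
  rewrite EFinB; apply: continuous_FTC2.
  - by rewrite -subr_gt0 opprK addr_gt0.
  - exact: continuous_subspaceT.
  - have cF x : {for x, continuous F}.
      by apply: differentiable_continuous; apply/derivable1_diffP.
    split => //.
    + exact: cvg_at_right_filter (cF _).
    + exact: cvg_at_left_filter (cF _).
  - by move=> x _; rewrite derive1E; apply: derive_val.
have cvgI : (\int[mu]_(x in I n) (f x)%:E)%E @[n --> \oo] -->
    (\int[mu]_x (f x)%:E)%E.
  under eq_fun do rewrite integral_mkcond.
  have [|||||_ _] := @dominated_convergence _ _ _ mu setT measurableT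
    (fun n => (EFin \o f) \_ (I n)) (EFin \o f) (abse \o (EFin \o f)).
  - move=> n; apply/(measurable_restrictT _ _).1; first exact: measurable_itv.
    by apply: measurable_funTS; exact/measurable_EFinP.
  - exact/measurable_EFinP.
  - apply/aeW => x _; apply: cvg_near_cst.
    near=> n; rewrite patchE mem_set// /I/= in_itv/=.
    have : `|x| <= n.+1%:R.
      rewrite (@le_trans _ _ n%:R) ?ler_nat//.
      by near: n; exact: nbhs_infty_ger.
    by rewrite ler_norml.
  - exact: integrable_abse.
  - apply/aeW => x n _; rewrite patchE; case: ifP => //= _.
    by rewrite /point/= normr0 lee_fin.
  - exact.
have cvg0 : (F n.+1%:R - F (- n.+1%:R))%:E @[n --> \oo] --> (0 - 0)%:E.
  by apply: cvg_EFin; [exact: nearW|exact: cvgB].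
rewrite (_ : (fun n => _) = (fun n => \int[mu]_(x in I n) (f x)%:E)%E) in cvg0.
  by rewrite /Rintegral (cvg_unique _ cvgI cvg0)//= subrr.
by apply/funext => n; rewrite FTC.
Unshelve. all: by end_near. Qed.

End TotalDerivative.

Lemma is_derive_gauss (R : realType) (a x : R) :
  is_derive x 1 (gauss a) (- (2 * a * x) * gauss a x).
Proof.
have h1 : is_derive x 1 (fun x : R => x ^+ 2) (2 * x).
  have h1 := @is_deriveX _ _ id 2 x 1 1 (is_derive_id x 1).
  by apply: is_derive_eq h1 _; rewrite /GRing.scale/= expr1 mulr1.
have h2 := @is_deriveZ _ _ _ (fun x : R => x ^+ 2) a x 1 _ h1.
have h : is_derive x 1 (fun x => - (a * x ^+ 2)) (- (2 * a * x)).
  apply: is_derive_eq (is_deriveN h2) _.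
  by rewrite /GRing.scale/=; ring.
have := @is_derive1_comp _ expR (fun x => - (a * x ^+ 2)) x _ _ _ h.
by move/(_ _ _)/is_derive_eq; apply; rewrite /gauss mulrC.
Qed.

Section GaussianFourier.
Context {R : realType}.
Notation mu := (@lebesgue_measure R).
Variables (a th : R).
Hypothesis a0 : 0 < a.

Let is_derive_lin (k c x : R) : is_derive x 1 (fun x => k * x + c) k.
Proof.
have := @is_deriveD _ _ _ (k \*: id) (cst c) x 1 _ _ _ _.
move/(_ _ _ _ _)/is_derive_eq; apply.
by rewrite addr0 /GRing.scale/= mulr1.
Qed.

Let is_derive_sin_gauss xi (x : R) :
  is_derive x 1 (fun x => sin (xi * x + th) * gauss a x)
   (xi * (cos (xi * x + th) * gauss a x) -
    2 * a * (x * sin (xi * x + th) * gauss a x)).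
Proof.
have h := @is_derive1_comp _ sin (fun x => xi * x + th) x _ _
  (is_derive_sin (xi * x + th)) (is_derive_lin xi th x).
apply: is_derive_eq (is_deriveM h (is_derive_gauss a x)) _.
by rewrite /GRing.scale/=; ring.
Qed.

Let is_derive_freq x (xi : R) :
  is_derive xi 1 (fun xi => cos (xi * x + th) * gauss a x)
   (- (x * sin (xi * x + th) * gauss a x)).
Proof.
have h := @is_derive1_comp _ cos (fun xi => x * xi + th) xi _ _
  (is_derive_cos (x * xi + th)) (is_derive_lin x th xi).
have h1 := is_deriveM h (is_derive_cst (gauss a x) xi 1).
rewrite (_ : (fun xi0 => _) =
  ((cos \o (fun xi => x * xi + th)) * cst (gauss a x))%R); last first.
  by apply/funext => z; rewrite /= [z * x]mulrC.
apply: is_derive_eq h1 _.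
by rewrite /GRing.scale/= [xi * x]mulrC; ring.
Qed.

Let integrable_cos xi :
  mu.-integrable setT (EFin \o (fun x => cos (xi * x + th) * gauss a x)).
Proof.
apply: (@le_Rintegrable _ _ _ mu _ (gauss a)); last exact: integrable_gauss.
- apply: measurable_funM; last exact: measurable_gauss.
  apply: measurableT_comp; first exact: measurable_cos.
  by apply: measurable_funD => //; exact: measurable_funM.
- by move=> x; rewrite normrM (ger0_norm (gauss_ge0 _ _)) ler_piMl ?gauss_ge0 ?cos_max.
Qed.

Let integrable_dominant :
  mu.-integrable setT (EFin \o (fun x => gauss a x + x ^+ 2 * gauss a x)).
Proof. exact: (RintegrableD (integrable_gauss a0) (integrable_sqr_gauss a0)). Qed.

(* |x| <= 1 + x^2, a bound independent of the frequency, as differentiation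
   under the integral sign requires. *)
Let norm_xsin_le xi x :
  `|x * sin (xi * x + th) * gauss a x| <= gauss a x + x ^+ 2 * gauss a x.
Proof.
rewrite -[X in _ <= X + _]mul1r -mulrDl normrM (ger0_norm (gauss_ge0 _ _)).
rewrite ler_wpM2r ?gauss_ge0// normrM.
rewrite (@le_trans _ _ `|x|)// ?ler_piMr ?sin_max//.
rewrite -(@real_normK _ x)// ?num_real//.
have := sqr_ge0 (`|x| - 1); have := normr_ge0 x; nra.
Qed.

Let integrable_xsin xi :
  mu.-integrable setT (EFin \o (fun x => x * sin (xi * x + th) * gauss a x)).
Proof.
apply: (@le_Rintegrable _ _ _ mu _ _ _ (norm_xsin_le xi) integrable_dominant).
apply: measurable_funM; last exact: measurable_gauss.
apply: measurable_funM => //.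
apply: measurableT_comp; first exact: measurable_sin.
by apply: measurable_funD => //; exact: measurable_funM.
Qed.

Let Phi xi := \int[mu]_x (cos (xi * x + th) * gauss a x).

Let is_derive_Phi (xi : R) :
  is_derive xi 1 Phi (- \int[mu]_x (x * sin (xi * x + th) * gauss a x)).
Proof.
pose f xi x := cos (xi * x + th) * gauss a x.
have d1 y x : derive1 (f ^~ x) y = - (x * sin (y * x + th) * gauss a x).
  by rewrite derive1E; exact: (@derive_val _ _ _ _ _ _ _ (is_derive_freq x y)).
have itv : [set` `](xi - 1), (xi + 1)[] xi.
  by rewrite /= in_itv/=; apply/andP; split; lra.
have intf (y : R) : [set` `](xi - 1), (xi + 1)[] y -> mu.-integrable setT (EFin \o f y).
  by move=> _; exact: integrable_cos.
have derf (y : R) x : [set` `](xi - 1), (xi + 1)[] y -> setT x ->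
  derivable (f ^~ x) y 1.
  by move=> _ _; exact: (@ex_derive _ _ _ _ _ _ _ (is_derive_freq x y)).
have G0 (x : R) : 0 <= gauss a x + x ^+ 2 * gauss a x.
  by rewrite addr_ge0 ?gauss_ge0// mulr_ge0 ?gauss_ge0 ?sqr_ge0.
have G_ub (y : R) x : [set` `](xi - 1), (xi + 1)[] y -> setT x ->
    `|partial1of2 f y x| <= gauss a x + x ^+ 2 * gauss a x.
  by move=> _ _; rewrite /partial1of2 d1 normrN.
have D := derivable_under_integral measurableT itv intf derf G0 integrable_dominant G_ub.
have E := differentiation_under_integral measurableT itv intf derf G0 integrable_dominant G_ub.
apply: DeriveDef => //.
rewrite -derive1E E -mulN1r -RintegralZl//.
by apply: eq_Rintegral => x _; rewrite /partial1of2 d1 mulN1r.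
Qed.

Let gauss_nat_le n : gauss a n.+1%:R <= a^-1 * n.+1%:R^-1.
Proof.
have n0 : 0 < n.+1%:R :> R by [].
have n1 : 1 <= n.+1%:R :> R by rewrite ler1n.
rewrite /gauss expRN -invfM lef_pV2 ?posrE ?expR_gt0 ?mulr_gt0//.
apply: le_trans (expR_ge1Dx _); rewrite mulrC.
rewrite (@le_trans _ _ (a * n.+1%:R ^+ 2)) ?lerDr// mulrC ler_pM2l//.
by rewrite expr2 ler_peMl// ltW.
Qed.

Let cvg_gauss_nat (u : nat -> R) : (forall n, `|u n| <= gauss a n.+1%:R) ->
  u n @[n --> \oo] --> 0.
Proof.
move=> ug; apply/norm_cvg0P.
have h : a^-1 * n.+1%:R^-1 @[n --> \oo] --> (0 : R).
  by rewrite -[X in _ --> X](mulr0 a^-1); apply: cvgMr; exact: cvg_harmonic.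
apply: squeeze_cvgr (cvg_cst 0) h.
apply: nearW => n; rewrite normr_ge0/=.
exact: le_trans (ug n) (gauss_nat_le n).
Qed.

Let continuous_lin k c : continuous (fun x : R => k * x + c).
Proof.
by move=> x; apply: cvgD; [apply: cvgM; [exact: cvg_cst|exact: cvg_id]|exact: cvg_cst].
Qed.

Let continuous_cos_lin xi : continuous (fun x : R => cos (xi * x + th)).
Proof.
move=> x; apply: (@continuous_comp _ _ _ (fun x : R => xi * x + th) cos).
  exact: continuous_lin.
exact: continuous_cos.
Qed.

Let continuous_sin_lin xi : continuous (fun x : R => sin (xi * x + th)).
Proof.
move=> x; apply: (@continuous_comp _ _ _ (fun x : R => xi * x + th) sin).
  exact: continuous_lin.
exact: continuous_sin.
Qed.

(* The derivative in x of sin (xi x + th) exp (- a x^2) integrates to 0, which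
   turns [is_derive_Phi] into the differential equation
   Phi' = - xi / (2 a) Phi. *)
Let Phi_ode xi : \int[mu]_x (x * sin (xi * x + th) * gauss a x) = xi / (2 * a) * Phi xi.
Proof.
have h : \int[mu]_x (xi * (cos (xi * x + th) * gauss a x) -
    2 * a * (x * sin (xi * x + th) * gauss a x)) = 0.
  apply: Rintegral_derivative (is_derive_sin_gauss xi) _ _ _.
  - move=> x; apply: cvgB.
      apply: cvgM; first exact: cvg_cst.
      by apply: cvgM; [exact: continuous_cos_lin|exact: continuous_gauss].
    apply: cvgM; first exact: cvg_cst.
    apply: cvgM; last exact: continuous_gauss.
    by apply: cvgM; [exact: cvg_id|exact: continuous_sin_lin].
  - exact: (RintegrableB (RintegrableZl xi (integrable_cos xi))
      (RintegrableZl (2 * a) (integrable_xsin xi))).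
  - apply: cvg_gauss_nat => n; rewrite normrM (ger0_norm (gauss_ge0 _ _)).
    by rewrite ler_piMl ?gauss_ge0 ?sin_max.
  - apply: cvg_gauss_nat => n; rewrite normrM (ger0_norm (gauss_ge0 _ _)).
    by rewrite gaussN ler_piMl ?gauss_ge0 ?sin_max.
move: h; rewrite RintegralB//; last 2 first.
- exact/RintegrableZl/integrable_cos.
- exact/RintegrableZl/integrable_xsin.
rewrite !RintegralZl// => /eqP; rewrite subr_eq0 => /eqP h.
rewrite mulrAC /Phi h; field; exact: lt0r_neq0.
Qed.

(** Phi (xi) exp (xi^2 / (4 a)) has derivative 0 by the differential equation.
    Keeping a free phase [th] gives the cosine and sine transforms at once, and
    allows the three-dimensional transform to be computed one variable at a
    time. *)
Lemma Rintegral_cos_gauss xi : \int[mu]_x (cos (xi * x + th) * gauss a x) =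
  cos th * (Num.sqrt (pi / a) * gauss (4 * a)^-1 xi).
Proof.
rewrite -/(Phi xi).
have cstE : Phi xi * gauss (- (4 * a)^-1) xi = Phi 0 * gauss (- (4 * a)^-1) 0.
  apply: (@is_derive_0_is_cst _ (fun xi => Phi xi * gauss (- (4 * a)^-1) xi)).
  move=> y; apply: is_derive_eq (is_deriveM (is_derive_Phi y) (is_derive_gauss _ y)) _.
  rewrite /GRing.scale/= Phi_ode; field; exact: lt0r_neq0.
have Phi0 : Phi 0 = cos th * Num.sqrt (pi / a).
  rewrite /Phi; under eq_Rintegral do rewrite mul0r add0r.
  by rewrite RintegralZl ?Rintegral_gauss//; exact: integrable_gauss.
have g0 b : @gauss R b 0 = 1 by rewrite /gauss expr0n mulr0 oppr0 expR0.
move: cstE; rewrite Phi0 g0 mulr1 mulrA => <-.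
by rewrite -mulrA /gauss -expRD mulNr opprK subrr expR0 mulr1.
Qed.

End GaussianFourier.

(** * Gaussians in three variables *)

Section Integrals3.
Context {R : realType}.
Notation mu := (@lebesgue_measure R).

Section product.
Variables f1 f2 f3 : measurableTypeR R -> R.
Hypotheses (i1 : mu.-integrable setT (EFin \o f1))
  (i2 : mu.-integrable setT (EFin \o f2))
  (i3 : mu.-integrable setT (EFin \o f3)).

Lemma integrable_leb3 :
  leb3.-integrable setT
    (EFin \o (fun x : mR3 R => f1 x.1.1 * f2 x.1.2 * f3 x.2)).
Proof. exact: (@integrable_prodM R _ _ _ _ leb2 mu _ _ (integrable_prodM i1 i2) i3). Qed.

Lemma Rintegral_leb3 :
  \int[leb3]_x (f1 x.1.1 * f2 x.1.2 * f3 x.2) =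
  (\int[mu]_x f1 x) * (\int[mu]_x f2 x) * (\int[mu]_x f3 x).
Proof.
rewrite -(@Rintegral_prodM R _ _ _ _ mu mu)//.
by rewrite -(@Rintegral_prodM R _ _ _ _ leb2 mu)//; exact: integrable_prodM.
Qed.

End product.

Implicit Types (a x xi : R * R * R).

Definition gauss3 a x : R := gauss a.1.1 x.1.1 * gauss a.1.2 x.1.2 * gauss a.2 x.2.

(** The Fourier transform of [gauss a], by [Rintegral_cos_gauss] at [th = 0]. *)
Definition gauss_hat (a xi : R) : R := Num.sqrt (pi / a) * gauss (4 * a)^-1 xi.

Definition gauss3_hat a xi : R :=
  gauss_hat a.1.1 xi.1.1 * gauss_hat a.1.2 xi.1.2 * gauss_hat a.2 xi.2.

Definition pos3 a := [/\ 0 < a.1.1, 0 < a.1.2 & 0 < a.2].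

Lemma integrable_gauss3 a : pos3 a ->
  leb3.-integrable setT (EFin \o (gauss3 a : mR3 R -> R)).
Proof. by case=> ? ? ?; apply: integrable_leb3; exact: integrable_gauss. Qed.

Lemma measurable_dot3 d (T : measurableType d) (f g : T -> mR3 R) :
  measurable_fun setT f -> measurable_fun setT g ->
  measurable_fun setT (fun z => dot3 (f z) (g z)).
Proof.
move=> mf mg; rewrite /dot3.
have m1 (h : T -> mR3 R) : measurable_fun setT h -> measurable_fun setT (fun z => (h z).1.1).
  move=> mh; apply: (measurableT_comp measurable_fst).
  exact: (measurableT_comp measurable_fst mh).
have m2 (h : T -> mR3 R) : measurable_fun setT h -> measurable_fun setT (fun z => (h z).1.2).
  move=> mh; apply: (measurableT_comp measurable_snd).
  exact: (measurableT_comp measurable_fst mh).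
have m3 (h : T -> mR3 R) : measurable_fun setT h -> measurable_fun setT (fun z => (h z).2).
  by move=> mh; exact: (measurableT_comp measurable_snd mh).
apply: measurable_funD; last by apply: measurable_funM; exact: m3.
apply: measurable_funD; apply: measurable_funM; first exact: m1.
- exact: m1.
- exact: m2.
- exact: m2.
Qed.

Lemma normr_cosM_le y (g : R) : 0 <= g -> `|cos y * g| <= g.
Proof. by move=> g0; rewrite normrM (ger0_norm g0) ler_piMl ?cos_max. Qed.

Lemma integrable_cosM d (T : measurableType d) (m : {measure set T -> \bar R})
    (phi g : T -> R) : measurable_fun setT phi -> (forall x : T, 0 <= g x) ->
  m.-integrable setT (EFin \o g) ->
  m.-integrable setT (EFin \o (fun x : T => cos (phi x) * g x)).
Proof.
move=> mphi g0 ig; apply: (le_Rintegrable _ _ ig) => [|x].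
  apply: measurable_funM; first exact: (measurableT_comp (@measurable_cos R)).
  by apply/measurable_EFinP; exact: measurable_int ig.
exact: normr_cosM_le.
Qed.

Lemma gauss3_ge0 a x : 0 <= gauss3 a x.
Proof. by rewrite /gauss3 !mulr_ge0 ?gauss_ge0. Qed.

(** Integrating out one variable leaves the same integrand in the remaining
    ones, the phase [th] having absorbed their contribution. *)
Lemma Rintegral_cos_gauss3 a xi th : pos3 a ->
  \int[leb3]_x (cos (dot3 x xi + th) * gauss3 a x) = cos th * gauss3_hat a xi.
Proof.
move=> [a1 a2 a3].
have mlin (k c : R) : measurable_fun setT (fun x : measurableTypeR R => k * x + c).
  by apply: measurable_funD => //; exact: measurable_funM.
have int1 (b k c : R) : 0 < b ->
    mu.-integrable setT (EFin \o (fun x : R => cos (k * x + c) * gauss b x)).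
  move=> b0; apply: integrable_cosM => //; first exact: gauss_ge0.
  exact: integrable_gauss.
have split3 (x : mR2 R) y : cos (dot3 (x, y) xi + th) * gauss3 a (x, y) =
    gauss a.1.1 x.1 * gauss a.1.2 x.2 *
    (cos (xi.2 * y + (x.1 * xi.1.1 + x.2 * xi.1.2 + th)) * gauss a.2 y).
  rewrite /dot3/= /gauss3/= mulrCA; congr (_ * (cos _ * _)); ring.
have split2 (x y : R) : gauss a.1.1 x * gauss a.1.2 y *
      (cos (x * xi.1.1 + y * xi.1.2 + th) * gauss_hat a.2 xi.2) =
    gauss_hat a.2 xi.2 * gauss a.1.1 x *
    (cos (xi.1.2 * y + (xi.1.1 * x + th)) * gauss a.1.2 y).
  rewrite (_ : x * _ + _ + _ = xi.1.2 * y + (xi.1.1 * x + th)); ring.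
rewrite (@Rintegral_fubini _ _ _ _ _ leb2 mu); last 2 first.
- apply: integrable_cosM.
  + by apply: measurable_funD => //; exact: measurable_dot3.
  + exact: gauss3_ge0.
  + exact: integrable_gauss3.
- move=> x; under eq_fun do rewrite /= split3.
  exact: RintegrableZl (int1 _ _ _ a3).
under eq_Rintegral => x _.
  under eq_Rintegral do rewrite split3.
  rewrite RintegralZl//; last exact: int1.
  rewrite Rintegral_cos_gauss// -/(gauss_hat _ _).
  over.
rewrite (@Rintegral_fubini _ _ _ _ _ mu mu); last 2 first.
- have mphi : measurable_fun setT
      (fun z : mR2 R => z.1 * xi.1.1 + z.2 * xi.1.2 + th).
    apply: measurable_funD => //; apply: measurable_funD; apply: measurable_funM => //.
  have := integrable_cosM mphi (fun z => mulr_ge0 (gauss_ge0 a.1.1 z.1) (gauss_ge0 a.1.2 z.2))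
    (integrable_prodM (integrable_gauss a1) (integrable_gauss a2)).
  move=> /(RintegrableZl (gauss_hat a.2 xi.2)); apply: eq_integrable => // z _ /=.
  by congr (_%:E); ring.
- move=> x; under eq_fun do rewrite /= split2.
  exact: RintegrableZl (int1 _ _ _ a2).
under eq_Rintegral => x _.
  under eq_Rintegral do rewrite split2 /=.
  rewrite RintegralZl//; last exact: int1.
  rewrite Rintegral_cos_gauss// -/(gauss_hat _ _).
  rewrite (_ : _ * _ = gauss_hat a.2 xi.2 * gauss_hat a.1.2 xi.1.2 *
    (cos (xi.1.1 * x + th) * gauss a.1.1 x)); last by ring.
  over.
rewrite RintegralZl//; last exact: int1.
by rewrite Rintegral_cos_gauss// -/(gauss_hat _ _) /gauss3_hat; ring.
Qed.

Local Open Scope complex_scope.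

Lemma cintegral3_expi (phi g : R * R * R -> R) :
  cintegral3 (fun x => expi (phi x) * (g x)%:C) =
  (\int[leb3]_x (cos (phi x) * g x)) +i* (\int[leb3]_x (sin (phi x) * g x)).
Proof.
rewrite /cintegral3; congr (_ +i* _); apply: eq_Rintegral => x _ /=.
  by rewrite mulr0 subr0.
by rewrite mulr0 add0r.
Qed.

Lemma fourier3_gauss3 a xi : pos3 a ->
  fourier3 (fun x => (gauss3 a x)%:C) xi = (gauss3_hat a xi)%:C.
Proof.
move=> apos; rewrite /fourier3 cintegral3_expi; congr (_ +i* _).
  under eq_Rintegral do rewrite cosN -[dot3 _ _]addr0.
  by rewrite Rintegral_cos_gauss3// cos0 mul1r.
under eq_Rintegral do rewrite sinN -cosDpihalf.
by rewrite Rintegral_cos_gauss3// cos_pihalf mul0r.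
Qed.

End Integrals3.

(** * The phase near the xi3-axis *)

Section PhaseBounds.
Context {R : realType}.
Implicit Types (xi : R * R * R) (F : R).

Lemma normr_sin_le (x : R) : `|sin x| <= `|x|.
Proof.
have h (y : R) : 0 <= y -> `|sin y| <= y.
  move=> y0.
  have [|c _] := @MVT_segment R sin cos 0 y y0 (fun x _ => is_derive_sin x).
  - exact: continuous_subspaceT (@continuous_sin R).
  - rewrite sin0 !subr0 => ->; by rewrite normrM (ger0_norm y0) ler_piMl ?cos_max.
have [x0|x0] := leP 0 x; first by rewrite [leRHS]ger0_norm// h.
rewrite -normrN -sinN -[leRHS]normrN [leRHS]ger0_norm ?h// ?oppr_ge0 ltW//.
Qed.

Lemma cos_ge_sqr (x : R) : 1 - x ^+ 2 / 2 <= cos x.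
Proof.
have -> : cos x = 1 - 2 * sin (x / 2) ^+ 2.
  rewrite [in LHS](_ : x = (x / 2) *+ 2); last by rewrite -mulr_natr divfK.
  by rewrite cos_mulr2n cos2sin2; ring.
have : sin (x / 2) ^+ 2 <= (x / 2) ^+ 2.
  rewrite -(real_normK (num_real (sin _))) -(real_normK (num_real (x / 2))).
  by rewrite ler_sqr ?nnegrE// normr_sin_le.
lra.
Qed.

Lemma phaseF_ge0 F xi : 0 < F -> 0 <= phaseF F xi.
Proof.
by move=> F0; rewrite /phaseF divr_ge0 ?sqrtr_ge0// mulr_ge0 ?sqrtr_ge0// ltW.
Qed.

Lemma enorm3_sqr xi : enorm3 xi ^+ 2 = xi.1.1 ^+ 2 + xi.1.2 ^+ 2 + xi.2 ^+ 2.
Proof.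
by rewrite /enorm3 /dot3 -!expr2 sqr_sqrtr// !addr_ge0 ?sqr_ge0.
Qed.

Lemma phaseF_le1 F xi : 1 < F -> phaseF F xi <= 1.
Proof.
move=> F1; have F0 : 0 < F by lra.
have [xi0|xi0] := eqVneq (enorm3 xi) 0.
  by rewrite /phaseF xi0 mulr0 invr0 mulr0.
have n0 : 0 < enorm3 xi by rewrite lt_neqAle eq_sym xi0 sqrtr_ge0.
rewrite /phaseF ler_pdivrMr ?mulr_gt0// mul1r.
rewrite -ler_sqr ?nnegrE ?sqrtr_ge0 ?mulr_ge0 ?sqrtr_ge0 ?(ltW F0)//.
rewrite exprMn !enorm3_sqr/=.
have := sqr_ge0 xi.1.1; have := sqr_ge0 xi.1.2.
have : 1 <= F ^+ 2 by rewrite expr_ge1// ltW.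
set A := xi.1.1 ^+ 2; set B := xi.1.2 ^+ 2; nra.
Qed.

(** As 0 <= p_F <= 1, one has 1 - p_F <= 1 - p_F^2, and
    1 - p_F^2 = (1 - F^{-2}) (xi1^2 + xi2^2) / |xi|^2. *)
Lemma onem_phaseF_le F xi : 1 < F -> 1 <= `|xi.2| ->
  1 - phaseF F xi <= xi.1.1 ^+ 2 + xi.1.2 ^+ 2.
Proof.
move=> F1 x31; have F0 : 0 < F by lra.
have x3 : 1 <= xi.2 ^+ 2 by rewrite -(real_normK (num_real _)) expr_ge1.
set A := xi.1.1 ^+ 2; set B := xi.1.2 ^+ 2.
have A0 : 0 <= A by exact: sqr_ge0.
have B0 : 0 <= B by exact: sqr_ge0.
have N2 : enorm3 xi ^+ 2 = A + B + xi.2 ^+ 2 by exact: enorm3_sqr.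
have p0 := phaseF_ge0 xi F0; have p1 := phaseF_le1 xi F1.
have p2 : phaseF F xi ^+ 2 * (F ^+ 2 * (A + B + xi.2 ^+ 2)) =
    A + B + F ^+ 2 * xi.2 ^+ 2.
  rewrite /phaseF expr_div_n exprMn N2 enorm3_sqr/= -/A -/B exprMn divfK//.
  by apply: lt0r_neq0; rewrite mulr_gt0 ?exprn_gt0//; lra.
have F2 : 1 <= F ^+ 2 by rewrite expr_ge1// ltW.
have : 1 - phaseF F xi <= 1 - phaseF F xi ^+ 2.
  by rewrite lerD2l lerN2 expr2 ler_piMl.
move/le_trans; apply.
have S1 : 1 <= A + B + xi.2 ^+ 2 by lra.
have : (1 - phaseF F xi ^+ 2) * (A + B + xi.2 ^+ 2) <= A + B.
  have F20 : 0 < F ^+ 2 by lra.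
  rewrite -(ler_pM2l F20); nra.
move=> h; apply: le_trans h; rewrite ler_peMr// subr_ge0.
by rewrite expr_le1.
Qed.

End PhaseBounds.

(** * Moments of the transformed Gaussian *)

Section GaussHat.
Context {R : realType}.
Notation mu := (@lebesgue_measure R).
Variable a : R.
Hypothesis a0 : 0 < a.

Let c0 : 0 < (4 * a)^-1. Proof. by rewrite invr_gt0 mulr_gt0. Qed.

Lemma gauss_hat_ge0 (xi : R) : 0 <= gauss_hat a xi.
Proof. by rewrite /gauss_hat mulr_ge0 ?sqrtr_ge0 ?gauss_ge0. Qed.

Lemma integrable_gauss_hat : mu.-integrable setT (EFin \o gauss_hat a).
Proof. exact/RintegrableZl/integrable_gauss. Qed.

Lemma Rintegral_gauss_hat : \int[mu]_xi gauss_hat a xi = 2 * pi.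
Proof.
rewrite /gauss_hat RintegralZl//; last exact: integrable_gauss.
rewrite Rintegral_gauss// -sqrtrM ?divr_ge0 ?pi_ge0 ?(ltW a0)//.
rewrite invrK (_ : pi / a * (pi * (4 * a)) = (2 * pi) ^+ 2); last by field; exact: lt0r_neq0.
by rewrite sqrtr_sqr ger0_norm// mulr_ge0// pi_ge0.
Qed.

Lemma integrable_sqr_gauss_hat :
  mu.-integrable setT (EFin \o (fun xi => xi ^+ 2 * gauss_hat a xi)).
Proof.
have := RintegrableZl (Num.sqrt (pi / a)) (integrable_sqr_gauss c0).
by apply: eq_integrable => // xi _ /=; rewrite /gauss_hat mulrCA.
Qed.

Lemma Rintegral_sqr_gauss_hat_le :
  \int[mu]_xi (xi ^+ 2 * gauss_hat a xi) <= 16 * a * (2 * pi).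
Proof.
under eq_Rintegral do rewrite mulrCA.
rewrite RintegralZl//; last exact: integrable_sqr_gauss.
apply: (le_trans (ler_wpM2l (sqrtr_ge0 _) (Rintegral_sqr_gauss_le c0))).
rewrite mulrCA -sqrtrM ?divr_ge0 ?pi_ge0 ?(ltW a0)//.
have -> : 2 / (4 * a)^-1 = 8 * a by rewrite invrK; ring.
have -> : 16 * a * (2 * pi) = 8 * a * (4 * pi) by ring.
rewrite ler_pM2l ?mulr_gt0//.
rewrite -[leRHS]ger0_norm ?mulr_ge0 ?pi_ge0// -sqrtr_sqr ler_sqrt ?sqr_ge0//.
rewrite invrK (_ : pi / a * (2 * pi * (4 * a)) = 8 * pi ^+ 2); last by field; exact: lt0r_neq0.
by rewrite exprMn ler_wpM2r ?sqr_ge0//; lra.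
Qed.

Lemma integrable_gauss_hat_near0 :
  mu.-integrable setT (EFin \o (fun xi => \1_(`]-1, 1[%classic : set R) xi * gauss_hat a xi)).
Proof.
apply: (@le_Rintegrable _ _ _ mu _ (gauss_hat a)); last exact: integrable_gauss_hat.
- apply: measurable_funM => //; apply: measurable_funM => //.
  exact: measurable_gauss.
- move=> xi; rewrite normrM (ger0_norm (gauss_hat_ge0 _)) ler_piMl ?gauss_hat_ge0//.
  by rewrite indicE normr_nat lern1 leq_b1.
Qed.

Lemma Rintegral_gauss_hat_near0_le :
  \int[mu]_xi (\1_(`]-1, 1[%classic : set R) xi * gauss_hat a xi) <= 2 * Num.sqrt (pi / a).
Proof.
apply: (@le_trans _ _ (\int[mu]_xi (Num.sqrt (pi / a) * \1_(`]-1, 1[%classic : set R) xi))).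
  apply: le_Rintegral => //; first exact: integrable_gauss_hat_near0.
    exact: RintegrableZl (integrable_indic_itv (-1) 1 false true).
  move=> xi _; rewrite mulrC ler_wpM2r// /gauss_hat ler_piMr ?sqrtr_ge0//.
  by rewrite /gauss expR_le1 oppr_le0 mulr_ge0 ?sqr_ge0// ltW.
rewrite RintegralZl//; last exact: (integrable_indic_itv (-1) 1 false true).
rewrite /Rintegral integral_indic// setIT/= lebesgue_measure_itv/=.
rewrite lte_fin gtrN// /= opprK mulrC//.
Qed.

End GaussHat.

(** * Lower bound for the oscillatory integral *)

Section OscillatoryIntegral.
Context {R : realType}.
Notation mu := (@lebesgue_measure R).
Implicit Types (a x xi : R * R * R).

Lemma gauss3_hat_ge0 a xi : pos3 a -> 0 <= gauss3_hat a xi.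
Proof.
case=> a1 a2 a3; apply: mulr_ge0; last exact: gauss_hat_ge0.
by apply: mulr_ge0; exact: gauss_hat_ge0.
Qed.

Lemma integrable_gauss3_hat a : pos3 a ->
  leb3.-integrable setT (EFin \o (gauss3_hat a : mR3 R -> R)).
Proof. by case=> ? ? ?; apply: integrable_leb3; exact: integrable_gauss_hat. Qed.

Lemma sqr_sum3_le (u v w : R) :
  (u + v + w) ^+ 2 <= 3 * u ^+ 2 + 3 * v ^+ 2 + 3 * w ^+ 2.
Proof.
rewrite -subr_ge0 (_ : _ - _ = (u - v) ^+ 2 + (v - w) ^+ 2 + (u - w) ^+ 2).
  by rewrite !addr_ge0 ?sqr_ge0.
ring.
Qed.

(** With 1 - cos y <= y^2 / 2 and (p_F - 1)^2 <= 1 - p_F, the loss is a sum of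
    functions of one frequency variable each, so that its integral against a
    product of Gaussians factorizes. The slab |xi3| < 1, where p_F is not close
    to 1, is paid for by the indicator. *)
Lemma cos_phase_ge (F k : R) x xi : 1 < F ->
  1 - ((3 * x.1.1 ^+ 2 + k ^+ 2) * xi.1.1 ^+ 2 +
       (3 * x.1.2 ^+ 2 + k ^+ 2) * xi.1.2 ^+ 2 +
       3 * x.2 ^+ 2 * xi.2 ^+ 2 + k ^+ 2 * \1_(`]-1, 1[%classic : set R) xi.2)
  <= cos (dot3 x xi + k * (phaseF F xi - 1)).
Proof.
move=> F1; apply: le_trans (cos_ge_sqr _); rewrite lerD2l lerN2.
have F0 : 0 < F by lra.
set p := phaseF F xi; set ind := \1_ _ _.
have p0 : 0 <= p by exact: phaseF_ge0.
have p1 : p <= 1 by exact: phaseF_le1.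
have pind : 1 - p <= ind + xi.1.1 ^+ 2 + xi.1.2 ^+ 2.
  have s1 := sqr_ge0 xi.1.1; have s2 := sqr_ge0 xi.1.2.
  rewrite /ind indicE; have [_|nx3] := boolP (xi.2 \in _); first by rewrite /=; lra.
  rewrite add0r; apply: onem_phaseF_le => //.
  move: nx3; rewrite notin_setE/= in_itv/= => /negP.
  by rewrite -ltr_norml -leNgt.
have dotle := sqr_sum3_le (x.1.1 * xi.1.1) (x.1.2 * xi.1.2) (x.2 * xi.2).
have q : (p - 1) ^+ 2 <= 1 - p by nra.
have k2 := sqr_ge0 k.
have kq : k ^+ 2 * (p - 1) ^+ 2 <= k ^+ 2 * (ind + xi.1.1 ^+ 2 + xi.1.2 ^+ 2).
  by rewrite ler_wpM2l// (le_trans q).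
have : (dot3 x xi + k * (p - 1)) ^+ 2 <=
    2 * dot3 x xi ^+ 2 + 2 * (k ^+ 2 * (p - 1) ^+ 2).
  rewrite -exprMn -subr_ge0 (_ : _ - _ = (dot3 x xi - k * (p - 1)) ^+ 2).
    exact: sqr_ge0.
  ring.
move: dotle; rewrite -/(dot3 x xi) !exprMn; lra.
Qed.

Lemma measurable_phaseF (F : R) :
  0 < F -> measurable_fun setT (phaseF F : mR3 R -> R).
Proof.
move=> F0.
have m1 : measurable_fun setT (fun xi : mR3 R => xi.1.1).
  exact: (measurableT_comp measurable_fst measurable_fst).
have m2 : measurable_fun setT (fun xi : mR3 R => xi.1.2).
  exact: (measurableT_comp measurable_snd measurable_fst).
have m3 : measurable_fun setT (fun xi : mR3 R => xi.2) by exact: measurable_snd.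
have menorm : measurable_fun setT (enorm3 : mR3 R -> R).
  apply: measurableT_comp; first exact: continuous_measurable_fun (@sqrt_continuous R).
  exact: measurable_dot3.
have mscale : measurable_fun setT
    (fun xi : mR3 R => ((xi.1.1, xi.1.2, F * xi.2) : mR3 R)).
  apply: measurable_fun_pair; last exact: measurable_funM.
  exact: measurable_fun_pair.
rewrite /phaseF; apply: measurable_funM.
  exact: (measurableT_comp menorm mscale).
rewrite (_ : (fun x => _) = (fun xi : mR3 R => (F * enorm3 xi) `^ (-1))).
  have mg : measurable_fun setT (fun xi : mR3 R => F * enorm3 xi).
    exact: measurable_funM.
  exact: (measurableT_comp (@measurable_powR R (-1)) mg).
by apply/funext => xi; rewrite powR_inv1// mulr_ge0 ?sqrtr_ge0 ?ltW.
Qed.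

(* P stands for 2 pi, the mass of one Gaussian factor, and S_i <= A_i P for its
   weighted masses. *)
Let half_cube_le (P c1 c2 c3 c4 S1 S2 S3 S4 A1 A2 A3 A4 : R) : 0 <= P ->
  0 <= c1 -> 0 <= c2 -> 0 <= c3 -> 0 <= c4 ->
  S1 <= A1 * P -> S2 <= A2 * P -> S3 <= A3 * P -> S4 <= A4 * P ->
  c1 * A1 + c2 * A2 + c3 * A3 + c4 * A4 <= 2^-1 ->
  P ^+ 3 / 2 <= P * P * P - (c1 * (S1 * P * P) + c2 * (P * S2 * P) +
    c3 * (P * P * S3) + c4 * (P * P * S4)).
Proof.
move=> P0 c10 c20 c30 c40 h1 h2 h3 h4 total.
have bound c S A : 0 <= c -> S <= A * P -> c * (P * P * S) <= P ^+ 3 * (c * A).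
  move=> c0 SA; rewrite (_ : P ^+ 3 * _ = c * (P * P * (A * P))); last by ring.
  by rewrite ler_wpM2l// ler_wpM2l// mulr_ge0.
have b1 := bound _ _ _ c10 h1; have b2 := bound _ _ _ c20 h2.
have b3 := bound _ _ _ c30 h3; have b4 := bound _ _ _ c40 h4.
have := ler_wpM2l (exprn_ge0 3 P0) total.
rewrite (_ : S1 * P * P = P * P * S1); last by ring.
rewrite (_ : P * S2 * P = P * P * S2); last by ring.
rewrite (_ : P * P * P = P ^+ 3); last by ring.
by rewrite !mulrDr; move: b1 b2 b3 b4; clear; lra.
Qed.

(** The two hypotheses bound the relative losses due to x . xi and to
    1 - p_F by a quarter each; the total mass of [gauss3_hat a] is
    (2 pi)^3. *)
Lemma Rintegral_cos_phase_ge (F k : R) a x : 1 < F -> pos3 a ->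
  48 * (x.1.1 ^+ 2 * a.1.1 + x.1.2 ^+ 2 * a.1.2 + x.2 ^+ 2 * a.2) <= 4^-1 ->
  k ^+ 2 * (16 * a.1.1 + 16 * a.1.2 + Num.sqrt (pi / a.2)) <= 4^-1 ->
  (2 * pi) ^+ 3 / 2 <=
  \int[leb3]_xi (cos (dot3 x xi + k * (phaseF F xi - 1)) * gauss3_hat a xi).
Proof.
move=> F1 apos hx hk; case: (apos) => a1 a2 a3.
have F0 : 0 < F by lra.
pose P : R := 2 * pi.
have P2 : 2 <= P by rewrite /P; have := @pi_ge2 R; lra.
have P0 : 0 < P by lra.
have i0 := integrable_gauss3_hat apos.
have g1 := integrable_gauss_hat a1; have g2 := integrable_gauss_hat a2.
have g3 := integrable_gauss_hat a3.
have s1 := integrable_sqr_gauss_hat a1; have s2 := integrable_sqr_gauss_hat a2.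
have s3 := integrable_sqr_gauss_hat a3.
have n3 := integrable_gauss_hat_near0 a3.
pose c1 := 3 * x.1.1 ^+ 2 + k ^+ 2; pose c2 := 3 * x.1.2 ^+ 2 + k ^+ 2.
pose c3 := 3 * x.2 ^+ 2; pose c4 := k ^+ 2.
have w1 := integrable_leb3 s1 g2 g3; have w2 := integrable_leb3 g1 s2 g3.
have w3 := integrable_leb3 g1 g2 s3; have w4 := integrable_leb3 g1 g2 n3.
have j1 := RintegrableZl c1 w1; have j2 := RintegrableZl c2 w2.
have j3 := RintegrableZl c3 w3; have j4 := RintegrableZl c4 w4.
have j12 := RintegrableD j1 j2; have j123 := RintegrableD j12 j3.
have j := RintegrableD j123 j4.
have icos : leb3.-integrable setT (EFin \o (fun xi : mR3 R =>
    cos (dot3 x xi + k * (phaseF F xi - 1)) * gauss3_hat a xi)).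
  apply: integrable_cosM => //; last by move=> xi; exact: gauss3_hat_ge0.
  apply: measurable_funD.
    exact: measurable_dot3.
  apply: measurable_funM => //; apply: measurable_funB => //.
  exact: measurable_phaseF.
apply: le_trans (le_Rintegral measurableT (RintegrableB i0 j) icos _); last first.
  move=> xi _.
  have := ler_wpM2r (gauss3_hat_ge0 xi apos) (cos_phase_ge k x xi F1).
  apply: le_trans; rewrite le_eqVlt; apply/orP; left; apply/eqP.
  by rewrite /gauss3_hat /c1 /c2 /c3 /c4; ring.
rewrite RintegralB// RintegralD// RintegralD// RintegralD//.
rewrite (RintegralZl _ measurableT w1) (RintegralZl _ measurableT w2).
rewrite (RintegralZl _ measurableT w3) (RintegralZl _ measurableT w4).
rewrite (Rintegral_leb3 s1 g2 g3) (Rintegral_leb3 g1 s2 g3).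
rewrite (Rintegral_leb3 g1 g2 s3) (Rintegral_leb3 g1 g2 n3).
rewrite (Rintegral_leb3 g1 g2 g3) !Rintegral_gauss_hat// -/P.
have := Rintegral_sqr_gauss_hat_le a1; have := Rintegral_sqr_gauss_hat_le a2.
have := Rintegral_sqr_gauss_hat_le a3; have := Rintegral_gauss_hat_near0_le a3.
rewrite -/P.
set S1 := \int[mu]_xi (xi ^+ 2 * gauss_hat a.1.1 xi).
set S2 := \int[mu]_xi (xi ^+ 2 * gauss_hat a.1.2 xi).
set S3 := \int[mu]_xi (xi ^+ 2 * gauss_hat a.2 xi).
set S4 := Rintegral _ _ _.
move: hk; set t := Num.sqrt _ => hk h4 h3 h2 h1.
have t0 : 0 <= t by exact: sqrtr_ge0.
have h4' : S4 <= t * P.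
  by apply: (le_trans h4); rewrite mulrC ler_wpM2l.
have c10 : 0 <= c1 by rewrite addr_ge0 ?sqr_ge0// mulr_ge0 ?sqr_ge0.
have c20 : 0 <= c2 by rewrite addr_ge0 ?sqr_ge0// mulr_ge0 ?sqr_ge0.
have c30 : 0 <= c3 by rewrite mulr_ge0 ?sqr_ge0.
have c40 : 0 <= c4 by exact: sqr_ge0.
apply: (half_cube_le (ltW P0) c10 c20 c30 c40 h1 h2 h3 h4').
rewrite (_ : _ + _ + _ + _ =
  48 * (x.1.1 ^+ 2 * a.1.1 + x.1.2 ^+ 2 * a.1.2 + x.2 ^+ 2 * a.2) +
  k ^+ 2 * (16 * a.1.1 + 16 * a.1.2 + t)); last by rewrite /c1 /c2 /c3 /c4; ring.
by move: hx hk {h1 h2 h3 h4 h4'}; clear; lra.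
Qed.

End OscillatoryIntegral.

(** * Evolution of Gaussian data *)

Section Propagation.
Context {R : realType}.
Implicit Types (a x xi : R * R * R) (eps F t : R) (b : bool).
Local Open Scope complex_scope.

Let phi b eps F t x xi : R :=
  dot3 x xi + (-1) ^+ b * (eps^-1 * t * phaseF F xi).

Lemma propagator_gauss3 b eps F a t x : pos3 a ->
  propagator b eps F (fun x => (gauss3 a x)%:C) t x =
  (\int[leb3]_xi (cos (phi b eps F t x xi) * gauss3_hat a xi)) +i*
  (\int[leb3]_xi (sin (phi b eps F t x xi) * gauss3_hat a xi)).
Proof.
move=> apos; rewrite /propagator -cintegral3_expi; congr cintegral3.
by apply/funext => xi; rewrite fourier3_gauss3.
Qed.

Let measurable_phi b eps F : 0 < F ->
  measurable_fun [set: (measurableTypeR R * mR3 R) * mR3 R]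
    (fun z => phi b eps F z.1.1 z.1.2 z.2).
Proof.
move=> F0; apply: measurable_funD.
  apply: measurable_dot3; last exact: measurable_snd.
  exact: (measurableT_comp measurable_snd measurable_fst).
apply: measurable_funM => //.
apply: measurable_funM.
  apply: measurable_funM => //.
  exact: (measurableT_comp measurable_fst measurable_fst).
exact: (measurableT_comp (measurable_phaseF F0) measurable_snd).
Qed.

Let measurable_gauss3_hat a : pos3 a -> measurable_fun setT (gauss3_hat a : mR3 R -> R).
Proof.
by move=> apos; apply/measurable_EFinP; exact: measurable_int (integrable_gauss3_hat apos).
Qed.

Lemma measurable_propagator_gauss3 b eps F a : 0 < F -> pos3 a ->
  let u := propagator b eps F (fun x => (gauss3 a x)%:C) in
  measurable_fun [set: measurableTypeR R * mR3 R] (fun z => complex.Re (u z.1 z.2)) /\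
  measurable_fun [set: measurableTypeR R * mR3 R] (fun z => complex.Im (u z.1 z.2)).
Proof.
move=> F0 apos u; split.
  rewrite (_ : (fun z => _) = fun z : measurableTypeR R * mR3 R =>
    \int[leb3]_xi (cos (phi b eps F z.1 z.2 xi) * gauss3_hat a xi)); last first.
    by apply/funext => z; rewrite /u propagator_gauss3.
  apply: (@measurable_Rintegral_param _ _ _ _ _ leb3
    (fun z : (measurableTypeR R * mR3 R) * mR3 R =>
    cos (phi b eps F z.1.1 z.1.2 z.2) * gauss3_hat a z.2)).
  apply: measurable_funM.
    exact: (measurableT_comp (@measurable_cos R) (measurable_phi b eps F0)).
  exact: (measurableT_comp (measurable_gauss3_hat apos) measurable_snd).
rewrite (_ : (fun z => _) = fun z : measurableTypeR R * mR3 R =>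
  \int[leb3]_xi (sin (phi b eps F z.1 z.2 xi) * gauss3_hat a xi)); last first.
  by apply/funext => z; rewrite /u propagator_gauss3.
apply: (@measurable_Rintegral_param _ _ _ _ _ leb3
    (fun z : (measurableTypeR R * mR3 R) * mR3 R =>
  sin (phi b eps F z.1.1 z.1.2 z.2) * gauss3_hat a z.2)).
apply: measurable_funM.
  apply: (measurableT_comp _ (measurable_phi b eps F0)).
  exact: measurable_sin.
exact: (measurableT_comp (measurable_gauss3_hat apos) measurable_snd).
Qed.

(** The left-hand side is the real part of e^{-ik} (A + iB). *)
Lemma normc_ge_rotate (A B k : R) : cos k * A + sin k * B <= Normc.normc (A +i* B).
Proof.
rewrite /Normc.normc.
rewrite (le_trans (ler_norm _))// -sqrtr_sqr ler_sqrt ?addr_ge0 ?sqr_ge0//.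
rewrite -[leRHS]mul1r -(cos2Dsin2 k) -subr_ge0.
rewrite (_ : _ - _ = (cos k * B - sin k * A) ^+ 2) ?sqr_ge0//; ring.
Qed.

(** Rotating u(t, x) by the constant phase that p_F = 1 would produce replaces
    p_F by p_F - 1 in the oscillatory integral. *)
Lemma normc_propagator_gauss3_ge b eps F a t x : 1 < F -> pos3 a ->
  48 * (x.1.1 ^+ 2 * a.1.1 + x.1.2 ^+ 2 * a.1.2 + x.2 ^+ 2 * a.2) <= 4^-1 ->
  (t / eps) ^+ 2 * (16 * a.1.1 + 16 * a.1.2 + Num.sqrt (pi / a.2)) <= 4^-1 ->
  (2 * pi) ^+ 3 / 2 <=
  Normc.normc (propagator b eps F (fun x => (gauss3 a x)%:C) t x).
Proof.
move=> F1 apos hx ht; have F0 : 0 < F by lra.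
pose k : R := (-1) ^+ b * (t / eps).
have k2 : k ^+ 2 = (t / eps) ^+ 2 by rewrite /k exprMn sqrr_sign mul1r.
rewrite propagator_gauss3//.
apply: le_trans (normc_ge_rotate _ _ k); rewrite -k2 in ht.
apply: (le_trans (Rintegral_cos_phase_ge F1 apos hx ht)).
have mphi : measurable_fun setT (phi b eps F t x : mR3 R -> R).
  apply: measurable_funD; first exact: measurable_dot3.
  by apply: measurable_funM => //; apply: measurable_funM => //; exact: measurable_phaseF.
have w0 : forall xi : mR3 R, 0 <= gauss3_hat a xi by move=> xi; exact: gauss3_hat_ge0.
have icos := integrable_cosM mphi w0 (integrable_gauss3_hat apos).
have isin : leb3.-integrable setT (EFin \o (fun xi : mR3 R =>
    sin (phi b eps F t x xi) * gauss3_hat a xi)).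
  have mphi' : measurable_fun setT (fun xi : mR3 R => phi b eps F t x xi - pi / 2).
    exact: measurable_funB.
  have := integrable_cosM mphi' w0 (integrable_gauss3_hat apos).
  by apply: eq_integrable => // xi _ /=; rewrite cosBpihalf.
rewrite -!RintegralZl// -RintegralD//; try exact: RintegrableZl.
rewrite le_eqVlt; apply/orP; left; apply/eqP; apply: eq_Rintegral => xi _.
rewrite (_ : dot3 x xi + _ = phi b eps F t x xi - k).
  by rewrite cosB; ring.
by rewrite /phi /k; ring.
Qed.

End Propagation.

(** * Lebesgue norms *)

Section MonotoneIntegral.
Import HBNNSimple.

(** The simple function [c] times the indicator of [D] competes in the supremum
    that defines the integral, whatever the nonnegative function [f]; in the
    mixed norm, [f] is a power of t |-> ||u(t)||_q. *)
Lemma le_cst_measure_integral (R : realType) d (T : measurableType d)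
    (mu : {measure set T -> \bar R}) (D : set T) (f : T -> \bar R) (c : R) :
  measurable D -> (0 <= c)%R -> (forall x, 0 <= f x)%E ->
  (forall x, D x -> c%:E <= f x)%E ->
  (c%:E * mu D <= \int[mu]_x f x)%E.
Proof.
move=> mD c0 f0 cf.
rewrite ge0_integralTE//.
pose h := scale_nnsfun (indic_nnsfun R mD) c0.
rewrite (_ : (c%:E * mu D)%E = sintegral mu h); last first.
  rewrite -integralT_nnsfun.
  under eq_integral do rewrite /h/= EFinM.
  rewrite ge0_integralZl_EFin//; last 2 first.
  - by move=> x _; rewrite lee_fin /mindic indicE ler0n.
  - exact/measurable_EFinP.
  by rewrite integral_indic// setIT.
apply: ereal_sup_ubound; exists h => //= x.
rewrite /h/= /mindic indicE; have [/set_mem Dx|_] := boolP (x \in D).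
  by rewrite mulr1 cf.
by rewrite mulr0.
Qed.

End MonotoneIntegral.

Lemma Lnorm_ge_cst (R : realType) d (T : measurableType d)
    (mu : {measure set T -> \bar R}) (D : set T) (f : T -> \bar R) (c m p : R) :
  measurable D -> mu D = m%:E -> 0 <= c -> 0 < p ->
  (forall x, D x -> c%:E <= f x)%E ->
  ((c * m `^ p^-1)%:E <= 'N[mu]_p%:E[f])%E.
Proof.
move=> mD muD c0 p0 cf; rewrite unlock.
have m0 : 0 <= m by rewrite -lee_fin -muD.
have -> : c * m `^ p^-1 = (c `^ p * m) `^ p^-1.
  by rewrite powRM ?powR_ge0// -powRrM divff ?lt0r_neq0// powRr1.
rewrite -poweR_EFin; apply: gt0_ler_poweR.
- by rewrite invr_ge0 ltW.
- by rewrite in_itv/= leey andbT lee_fin mulr_ge0// powR_ge0.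
- by rewrite in_itv/= leey andbT integral_ge0// => x _; exact: poweR_ge0.
rewrite EFinM -muD; apply: le_cst_measure_integral => //.
- exact: powR_ge0.
- by move=> x; exact: poweR_ge0.
- move=> x Dx; rewrite -poweR_EFin; apply: gt0_ler_poweR => //.
  + exact: ltW.
  + by rewrite in_itv/= leey andbT lee_fin.
  + by rewrite in_itv/= leey andbT abse_ge0.
  + exact: le_trans (cf x Dx) (lee_abs _).
Qed.

Section GaussNorm.
Context {R : realType}.
Implicit Types (a x : R * R * R) (r : R).
Local Open Scope complex_scope.

Lemma normc_realC (y : R) : 0 <= y -> Normc.normc y%:C = y.
Proof. by move=> y0; rewrite /Normc.normc/= expr0n addr0 sqrtr_sqr ger0_norm. Qed.

Lemma Lnorm3_gauss3 a r : pos3 a -> 0 < r ->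
  Lnorm3 r (fun x => (gauss3 a x)%:C) =
  ((Num.sqrt ((pi / r) ^+ 3 / (a.1.1 * a.1.2 * a.2))) `^ r^-1)%:E.
Proof.
move=> [a1 a2 a3] r0.
have ra1 : 0 < r * a.1.1 by rewrite mulr_gt0.
have ra2 : 0 < r * a.1.2 by rewrite mulr_gt0.
have ra3 : 0 < r * a.2 by rewrite mulr_gt0.
rewrite /Lnorm3 unlock -poweR_EFin; congr (_ `^ _)%E.
have E x : (`|(Normc.normc (gauss3 a x)%:C)%:E| `^ r)%E =
    (gauss3 (r * a.1.1, r * a.1.2, r * a.2) x)%:E.
  rewrite normc_realC ?gauss3_ge0// gee0_abs ?lee_fin ?gauss3_ge0// poweR_EFin.
  rewrite /gauss3 /gauss -!expRD/= -expRM; congr (expR _)%:E; ring.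
under eq_integral do rewrite E.
have pa : pos3 (r * a.1.1, r * a.1.2, r * a.2) by split.
have := integrable_gauss3 pa => ig.
rewrite -(fineK (integrable_fin_num measurableT ig)); congr EFin.
have := Rintegral_leb3 (integrable_gauss ra1) (integrable_gauss ra2) (integrable_gauss ra3).
rewrite /Rintegral => ->.
rewrite -!/(Rintegral _ _ _) !Rintegral_gauss//.
rewrite -!sqrtrM ?mulr_ge0 ?pi_ge0 ?invr_ge0 ?(ltW ra1) ?(ltW ra2)//.
congr Num.sqrt; field.
by rewrite !lt0r_neq0.
Qed.

End GaussNorm.

(** * Gaussians are Schwartz functions *)

Section GaussSchwartz.
Context {R : realType}.
Notation R3 := (R * R * R)%type.
Implicit Types (a x v : R3) (P Q : R3 -> R).

(** Polynomial functions, as a class closed under the operations produced by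
    the Leibniz rule; iterated derivatives of a Gaussian are products of such a
    function with the Gaussian. *)
Inductive polyfun3 : (R3 -> R) -> Prop :=
| PolyCst c : polyfun3 (fun _ => c)
| PolyX1 : polyfun3 (fun x => x.1.1)
| PolyX2 : polyfun3 (fun x => x.1.2)
| PolyX3 : polyfun3 (fun x => x.2)
| PolyD P Q : polyfun3 P -> polyfun3 Q -> polyfun3 (fun x => P x + Q x)
| PolyM P Q : polyfun3 P -> polyfun3 Q -> polyfun3 (fun x => P x * Q x).

Lemma linear_coord (f : {linear R3 -> R}) : continuous f ->
  (forall x, differentiable f x) /\ forall v x, 'D_v f x = f v.
Proof.
move=> cf; have df x : differentiable f x by exact: linear_differentiable.
by split=> // v x; rewrite deriveE// diff_lin.
Qed.

Lemma coord1_differentiable :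
  (forall x, differentiable (fun x : R3 => x.1.1) x) /\
  forall v x, 'D_v (fun x : R3 => x.1.1) x = v.1.1.
Proof.
apply: (@linear_coord (fst \o fst : {linear R3 -> R})).
by move=> x; apply: continuous_comp; exact: cvg_fst.
Qed.

Lemma coord2_differentiable :
  (forall x, differentiable (fun x : R3 => x.1.2) x) /\
  forall v x, 'D_v (fun x : R3 => x.1.2) x = v.1.2.
Proof.
apply: (@linear_coord (snd \o fst : {linear R3 -> R})).
by move=> x; apply: continuous_comp; [exact: cvg_fst|exact: cvg_snd].
Qed.

Lemma coord3_differentiable :
  (forall x, differentiable (fun x : R3 => x.2) x) /\
  forall v x, 'D_v (fun x : R3 => x.2) x = v.2.
Proof.
by apply: (@linear_coord (snd : {linear R3 -> R})) => x; exact: cvg_snd.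
Qed.

Lemma polyfun3_differentiable P x : polyfun3 P -> differentiable P x.
Proof.
elim=> [c||||{}P Q _ dP _ dQ|{}P Q _ dP _ dQ].
- exact: differentiable_cst.
- exact: coord1_differentiable.1.
- exact: coord2_differentiable.1.
- exact: coord3_differentiable.1.
- exact: differentiableD.
- exact: differentiableM.
Qed.

Lemma polyfun3_derive P v : polyfun3 P ->
  exists2 Q, polyfun3 Q & forall x, 'D_v P x = Q x.
Proof.
elim=> [c||||{}P Q pP [P' pP' dP] pQ [Q' pQ' dQ]|{}P Q pP [P' pP' dP] pQ [Q' pQ' dQ]].
- exists (fun=> 0) => [|x]; first exact: PolyCst.
  by rewrite (@derive_cst _ _ _ c).
- by exists (fun=> v.1.1) => [|x]; [exact: PolyCst|rewrite coord1_differentiable.2].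
- by exists (fun=> v.1.2) => [|x]; [exact: PolyCst|rewrite coord2_differentiable.2].
- by exists (fun=> v.2) => [|x]; [exact: PolyCst|rewrite coord3_differentiable.2].
- exists (fun x => P' x + Q' x) => [|x]; first exact: PolyD.
  by rewrite (@deriveD _ _ _ P Q) ?dP ?dQ//;
    apply: diff_derivable; exact: polyfun3_differentiable.
- exists (fun x => P x * Q' x + Q x * P' x) => [|x].
    by apply: PolyD; exact: PolyM.
  by rewrite (@deriveM _ _ P Q) ?dP ?dQ//;
    apply: diff_derivable; exact: polyfun3_differentiable.
Qed.

Let expo a x : R := - (a.1.1 * x.1.1 ^+ 2 + a.1.2 * x.1.2 ^+ 2 + a.2 * x.2 ^+ 2).

Let gauss3E a : gauss3 a = expR \o expo a.
Proof.
apply/funext => x; rewrite /gauss3 /gauss -!expRD/= /expo; congr expR; ring.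
Qed.

Let polyfun3_expo a : polyfun3 (expo a).
Proof.
rewrite (_ : expo a = fun x => (-1) * (a.1.1 * (x.1.1 * x.1.1) +
  a.1.2 * (x.1.2 * x.1.2) + a.2 * (x.2 * x.2))); last first.
  by apply/funext => x; rewrite /expo; ring.
apply: PolyM; first exact: PolyCst.
apply: PolyD; [apply: PolyD|]; apply: PolyM; try exact: PolyCst;
  by apply: PolyM; constructor.
Qed.

Lemma gauss3_differentiable a x : differentiable (gauss3 a) x.
Proof.
rewrite gauss3E; apply: differentiable_comp.
  exact: polyfun3_differentiable (polyfun3_expo a).
by apply/derivable1_diffP; exact: derivable_expR.
Qed.

Lemma derive_gauss3 a v : exists2 Q, polyfun3 Q &
  forall x, 'D_v (gauss3 a) x = Q x * gauss3 a x.
Proof.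
have [Q pQ dQ] := polyfun3_derive v (polyfun3_expo a).
exists Q => // x.
have dE : differentiable (expo a) x by exact: polyfun3_differentiable (polyfun3_expo a).
have dexp (y : R) : differentiable expR y.
  by apply/derivable1_diffP; exact: derivable_expR.
rewrite deriveE; last exact: gauss3_differentiable.
rewrite gauss3E diff_comp//= -(deriveE v dE) dQ diff1E// derive1E derive_val.
by rewrite /GRing.scale/=.
Qed.

Lemma iter_partial_gauss3 a s : exists2 P, polyfun3 P &
  iter_partial s (gauss3 a) = fun x => P x * gauss3 a x.
Proof.
elim: s => [|i s [P pP IH]]; rewrite /iter_partial/=.
  by exists (fun=> 1); [exact: PolyCst|apply/funext => x; rewrite mul1r].
have [Q pQ dQ] := derive_gauss3 a (basis3 i).
have [P' pP' dP] := polyfun3_derive (basis3 i) pP.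
exists (fun x => P x * Q x + P' x).
  by apply: PolyD => //; exact: PolyM.
apply/funext => x; rewrite -/(iter_partial s (gauss3 a)) IH.
rewrite (@deriveM _ _ P (gauss3 a)) ?dP ?dQ.
- by rewrite /GRing.scale/=; ring.
- by apply: diff_derivable; exact: polyfun3_differentiable.
- by apply: diff_derivable; exact: gauss3_differentiable.
Qed.

(* A weight that is at least 1, so that larger powers are larger. *)
Let N x : R := 1 + enorm3 x ^+ 2.

Let N_ge1 x : 1 <= N x.
Proof. by rewrite lerDl sqr_ge0. Qed.

Let N_ge0 x : 0 <= N x.
Proof. exact: le_trans ler01 (N_ge1 x). Qed.

Lemma polyfun3_bounded P : polyfun3 P ->
  exists2 c, 0 <= c & exists m, forall x, `|P x| <= c * N x ^+ m.
Proof.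
have coord (f : R3 -> R) : (forall x, f x ^+ 2 <= enorm3 x ^+ 2) ->
    exists2 c, 0 <= c & exists m, forall x, `|f x| <= c * N x ^+ m.
  move=> fN; exists 1 => //; exists 1%N => x; rewrite mul1r expr1 /N.
  have := fN x; rewrite -(real_normK (num_real (f x))).
  have := sqr_ge0 (`|f x| - 1); have := normr_ge0 (f x); nra.
elim=> [c||||{}P Q _ [c c0 [m hm]] _ [d d0 [n hn]]|{}P Q _ [c c0 [m hm]] _ [d d0 [n hn]]].
- by exists `|c| => //; exists 0%N => x; rewrite expr0 mulr1.
- apply: coord => x; rewrite enorm3_sqr.
  by rewrite -addrA lerDl addr_ge0 ?sqr_ge0.
- apply: coord => x; rewrite enorm3_sqr.
  by rewrite addrAC lerDr addr_ge0 ?sqr_ge0.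
- apply: coord => x; rewrite enorm3_sqr.
  by rewrite lerDr addr_ge0 ?sqr_ge0.
- exists (c + d); first exact: addr_ge0.
  exists (m + n)%N => x; apply: (le_trans (ler_normD _ _)).
  rewrite mulrDl; apply: lerD.
    apply: (le_trans (hm x)); rewrite ler_wpM2l// exprD.
    by rewrite ler_peMr ?exprn_ge0 ?N_ge0// exprn_ege1.
  apply: (le_trans (hn x)); rewrite ler_wpM2l// exprD.
  by rewrite ler_peMl ?exprn_ge0 ?N_ge0// exprn_ege1.
- exists (c * d); first exact: mulr_ge0.
  exists (m + n)%N => x; rewrite normrM exprD mulrACA.
  by apply: ler_pM.
Qed.

(** With [al] the smallest coefficient, the Gaussian is at most
    exp (al - al N), and N^{m+1} exp (- al N) is bounded because
    y^{m+1} <= (m+1)! exp y. *)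
Lemma gauss3_decay a m : pos3 a ->
  exists M, forall x, N x ^+ m * gauss3 a x <= M.
Proof.
move=> [a1 a2 a3].
pose al := Num.min a.1.1 (Num.min a.1.2 a.2).
have al0 : 0 < al by rewrite !lt_min a1 a2.
have [al1 al2 al3] : [/\ al <= a.1.1, al <= a.1.2 & al <= a.2].
  by split; rewrite /al !ge_min lexx ?orbT.
pose C := m.+1`!%:R / al ^+ m.+1 * expR al.
exists C => x; rewrite /C.
have N0 := N_ge0 x.
have step1 : N x ^+ m <= N x ^+ m.+1.
  by rewrite exprS ler_peMl ?exprn_ge0.
have step2 : N x ^+ m.+1 <= m.+1`!%:R / al ^+ m.+1 * expR (al * N x).
  have f0 : 0 < m.+1`!%:R :> R by rewrite ltr0n fact_gt0.
  have := expR_ge1Dxn m (mulr_ge0 (ltW al0) N0).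
  rewrite exprMn => h.
  rewrite mulrAC ler_pdivlMr ?exprn_gt0// mulrC [leRHS]mulrC -ler_pdivrMr//.
  by apply: le_trans h; rewrite lerDr.
have step3 : gauss3 a x <= expR (al - al * N x).
  rewrite gauss3E ler_expR /expo /N enorm3_sqr.
  have := sqr_ge0 x.1.1; have := sqr_ge0 x.1.2; have := sqr_ge0 x.2.
  nra.
apply: le_trans (ler_pM _ _ (le_trans step1 step2) step3) _.
- exact: exprn_ge0.
- exact: gauss3_ge0.
have <- : expR (al * N x) * expR (al - al * N x) = expR al.
  by rewrite -expRD; congr expR; ring.
by rewrite mulrA.
Qed.

Lemma schwartz_real_gauss3 a : pos3 a -> schwartz_real (gauss3 a).
Proof.
move=> apos; split=> s => [x|k]; have [P pP ->] := iter_partial_gauss3 a s.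
  apply: differentiableM; first exact: polyfun3_differentiable.
  exact: gauss3_differentiable.
have [c c0 [m hm]] := polyfun3_bounded pP.
have [M hM] := gauss3_decay (k + m) apos.
exists (c * M) => x.
have N0 := N_ge0 x.
rewrite normrM (ger0_norm (gauss3_ge0 a x)).
apply: (@le_trans _ _ (N x ^+ k * (c * N x ^+ m * gauss3 a x))).
  apply: ler_pM; rewrite ?exprn_ge0 ?sqrtr_ge0//.
  - by rewrite mulr_ge0 ?gauss3_ge0.
  - apply: lerXn2r; rewrite ?nnegrE ?sqrtr_ge0// /N.
    have := sqrtr_ge0 (dot3 x x); rewrite -/(enorm3 x).
    have := sqr_ge0 (enorm3 x - 1); nra.
  - by rewrite ler_wpM2r ?gauss3_ge0.
rewrite -mulrA mulrCA [N x ^+ k * (_ * _)]mulrA -exprD.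
by rewrite ler_wpM2l.
Qed.

Lemma iter_partial_cst0 s : iter_partial s (fun=> 0 : R) = fun=> 0.
Proof.
elim: s => [//|i s IH]; rewrite /iter_partial/= -/(iter_partial s _) IH.
by apply/funext => x; exact: (@derive_cst _ _ _ (0 : R)).
Qed.

Local Open Scope complex_scope.

Lemma schwartz_gauss3 a : pos3 a -> schwartz (fun x => (gauss3 a x)%:C).
Proof.
move=> apos; split; first exact: schwartz_real_gauss3.
split=> s => [x|k]; rewrite iter_partial_cst0; first exact: differentiable_cst.
by exists 0 => x; rewrite normr0 mulr0.
Qed.

End GaussSchwartz.

(** * Non-dispersing Gaussians *)

Section Counterexample.
Context {R : realType}.
Implicit Types (eps F p q r C T : R) (b : bool).
Local Open Scope complex_scope.

Lemma Lnorm3_sub_self r (h : R * R * R -> R[i]) : r != 0 ->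
  Lnorm3 r (fun x => h x - h x) = 0%E.
Proof.
move=> r0; rewrite /Lnorm3 -[RHS](@Lnorm0 _ _ _ (@leb3 R) r%:E) ?eqe//.
by apply: eq_Lnorm => x; rewrite subrr /Normc.normc/= expr0n addr0 sqrtr0.
Qed.

Lemma is_propagation_gauss3 b eps F r a : 0 < F -> r != 0 -> pos3 a ->
  is_propagation b eps F r (fun x => (gauss3 a x)%:C)
    (propagator b eps F (fun x => (gauss3 a x)%:C)).
Proof.
move=> F0 r0 apos.
have [mRe mIm] := measurable_propagator_gauss3 b eps F0 apos.
split=> //; exists (fun=> fun x => (gauss3 a x)%:C); split.
- by move=> _; exact: schwartz_gauss3.
- under eq_fun do rewrite Lnorm3_sub_self//; exact: cvg_cst.
- move=> t; under eq_fun do rewrite Lnorm3_sub_self//; exact: cvg_cst.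
Qed.

Lemma in_Lp3_gauss3 r a : 0 < r -> pos3 a -> in_Lp3 r (fun x => (gauss3 a x)%:C).
Proof.
move=> r0 apos; split.
- by apply/measurable_EFinP; exact: measurable_int (integrable_gauss3 apos).
- exact: measurable_cst.
- by rewrite Lnorm3_gauss3// ltry.
Qed.

Definition sym_box (l : R * R * R) : set (mR3 R) :=
  (`[- l.1.1, l.1.1] `*` `[- l.1.2, l.1.2]) `*` `[- l.2, l.2].

Lemma measurable_sym_box l : measurable (sym_box l).
Proof. by apply: measurableX => //; exact: measurableX. Qed.

Lemma leb3_sym_box l : 0 < l.1.1 -> 0 < l.1.2 -> 0 < l.2 ->
  leb3 (sym_box l) = ((2 * l.1.1) * (2 * l.1.2) * (2 * l.2))%:E.
Proof.
move=> l1 l2 l3; rewrite /leb3 product_measure1E//; last exact: measurableX.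
have itvE (k : R) : 0 < k -> lebesgue_measure `[- k, k]%classic = (2 * k)%:E.
  move=> k0; rewrite lebesgue_measure_itv/= lte_fin ifT; last lra.
  by rewrite -EFinB opprK -mulr2n mulr_natl.
have h := @product_measure1E _ _ _ _ R lebesgue_measure lebesgue_measure
  `[- l.1.1, l.1.1]%classic `[- l.1.2, l.1.2]%classic
  (measurable_itv _) (measurable_itv _).
rewrite EFinM; congr (_ * _)%E; last exact: itvE.
apply: (etrans h); rewrite EFinM; congr (_ * _)%E; exact: itvE.
Qed.

(** Coefficients of product 1, so that the Lebesgue norms do not depend on
    [eta]; a small [eta] gives a Gaussian wide in x1, x2 and thin in x3, whose
    transform concentrates around the xi3-axis. *)
Definition squeeze (eta : R) : R * R * R := (eta ^+ 2, eta ^+ 2, eta ^- 4).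

Lemma pos3_squeeze eta : 0 < eta -> pos3 (squeeze eta).
Proof. by move=> e0; split; rewrite /= ?invr_gt0 exprn_gt0. Qed.

Lemma Lnorm3_squeeze eta r : 0 < eta -> 0 < r ->
  Lnorm3 r (fun x => (gauss3 (squeeze eta) x)%:C) =
  ((Num.sqrt ((pi / r) ^+ 3)) `^ r^-1)%:E.
Proof.
move=> e0 r0; rewrite Lnorm3_gauss3//; last exact: pos3_squeeze.
congr ((Num.sqrt _ `^ _)%:E); rewrite /squeeze/=; field.
by rewrite !lt0r_neq0.
Qed.

(** On the box |x1|, |x2| <= 1 / (24 eta), |x3| <= eta^2 / 24, of volume
    12^{-3}, and for 0 <= t <= T, the solution is at least (2 pi)^3 / 2. *)
Lemma mixed_Lnorm_squeeze_ge b eps F p q T : 0 < eps -> 1 < F -> 0 < p -> 0 < q ->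
  0 < T -> exists2 eta, 0 < eta &
  (((2 * pi) ^+ 3 / 2 * (12^-1 ^+ 3) `^ q^-1 * T `^ p^-1)%:E <=
   mixed_Lnorm p q (propagator b eps F (fun x => (gauss3 (squeeze eta) x)%:C)))%E.
Proof.
move=> eps0 F1 p0 q0 T0.
pose K := T / eps; have K0 : 0 < K by rewrite divr_gt0.
(* 12 K eta <= 1 makes K^2 (16 eta^2 + 16 eta^2 + 2 eta^2) <= 34 / 144. *)
pose eta := (1 + 12 * K)^-1.
have eta0 : 0 < eta by rewrite invr_gt0; lra.
have etaK : 12 * (K * eta) <= 1.
  rewrite mulrA /eta ler_pdivrMr; lra.
clearbody eta; exists eta => //.
have c0 : 0 <= (2 * pi) ^+ 3 / 2 :> R.
  by rewrite divr_ge0// exprn_ge0// mulr_ge0// pi_ge0.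
have sq : Num.sqrt (pi / (squeeze eta).2) <= 2 * eta ^+ 2.
  rewrite /squeeze/= invrK (_ : pi * eta ^+ 4 = pi * (eta ^+ 2) ^+ 2); last by rewrite -exprM.
  rewrite sqrtrM ?pi_ge0// sqrtr_sqr ger0_norm ?sqr_ge0// ler_wpM2r ?sqr_ge0//.
  rewrite -[leRHS]ger0_norm// -sqrtr_sqr ler_sqrt ?sqr_ge0//.
  by have := @pihalf_lt2 R; lra.
(* 48 * 3 / 24^2 = 1 / 4. *)
pose l : R * R * R := (24^-1 / eta, 24^-1 / eta, 24^-1 * eta ^+ 2).
have lV : leb3 (sym_box l) = (12^-1 ^+ 3)%:E.
  rewrite leb3_sym_box/= ?mulr_gt0 ?invr_gt0 ?exprn_gt0//.
  congr EFin; field; exact: lt0r_neq0.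
rewrite /mixed_Lnorm; apply: (@Lnorm_ge_cst R _ _ lebesgue_measure `[0, T]%classic) => //.
- by rewrite /= lebesgue_measure_itv/= lte_fin T0 sube0.
- by rewrite mulr_ge0// powR_ge0.
move=> t tI; have /andP[t0 tT] : 0 <= t <= T by move: tI; rewrite /= in_itv.
rewrite /Lnorm3; apply: (Lnorm_ge_cst (measurable_sym_box l)) => // x.
move=> [[/=]]; rewrite !in_itv/= -!ler_norml => x1 x2 x3.
rewrite lee_fin.
apply: normc_propagator_gauss3_ge => //; first exact: pos3_squeeze.
- have sqr_le (y z : R) : `|y| <= z -> y ^+ 2 <= z ^+ 2.
    move=> yz; rewrite -(real_normK (num_real y)).
    by rewrite lerXn2r ?nnegrE// (le_trans _ yz).
  have e2 : 0 < eta ^+ 2 by rewrite exprn_gt0.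
  have e4 : 0 < eta ^- 4 by rewrite invr_gt0 exprn_gt0.
  have y1 := sqr_le _ _ x1; have y2 := sqr_le _ _ x2; have y3 := sqr_le _ _ x3.
  have {}y1 : x.1.1 ^+ 2 * eta ^+ 2 <= 576^-1.
    apply: (le_trans (ler_wpM2r (ltW e2) y1)).
    rewrite le_eqVlt; apply/orP; left; apply/eqP; field; exact: lt0r_neq0.
  have {}y2 : x.1.2 ^+ 2 * eta ^+ 2 <= 576^-1.
    apply: (le_trans (ler_wpM2r (ltW e2) y2)).
    rewrite le_eqVlt; apply/orP; left; apply/eqP; field; exact: lt0r_neq0.
  have {}y3 : x.2 ^+ 2 * eta ^- 4 <= 576^-1.
    apply: (le_trans (ler_wpM2r (ltW e4) y3)).
    rewrite le_eqVlt; apply/orP; left; apply/eqP; field; exact: lt0r_neq0.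
  rewrite /squeeze/=; lra.
- have tK : (t / eps) ^+ 2 <= K ^+ 2.
    apply: lerXn2r; rewrite ?nnegrE ?divr_ge0 ?(ltW eps0) ?(ltW T0)//.
    by rewrite ler_pM2r ?invr_gt0.
  have Ke : (K * eta) ^+ 2 <= 144^-1.
    have Ke0 : 0 <= K * eta by rewrite mulr_ge0 ?ltW.
    have -> : 144^-1 = 12^-1 ^+ 2 :> R by field.
    by apply: lerXn2r; rewrite ?nnegrE//; lra.
  apply: (@le_trans _ _ (K ^+ 2 * (34 * eta ^+ 2))).
    apply: ler_pM; rewrite ?sqr_ge0//.
      by rewrite !addr_ge0 ?sqrtr_ge0// mulr_ge0 ?sqr_ge0.
    by move: sq; rewrite /squeeze/=; lra.
  rewrite (_ : K ^+ 2 * (34 * eta ^+ 2) = 34 * (K * eta) ^+ 2); last by ring.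
  lra.
Qed.

End Counterexample.

Unset Implicit Arguments.

Local Close Scope classical_set_scope.

Theorem mainTheorem3 (R : realType) (eps F : R) (b : bool)
    (eps_gt0 : 0 < eps) (F_gt1 : 1 < F) :
  ~ exists p q r C : R,
      [/\ 2 < p, 2 < q, 2 < r & 0 < C] /\
      strichartz_estimate b eps F p q r C.
Proof.
move=> [p [q [r [C [[p2 q2 r2 C0] est]]]]].
have p0 : 0 < p by lra.
have q0 : 0 < q by lra.
have r0 : 0 < r by lra.
have F0 : 0 < F by lra.
pose c : R := (2 * pi) ^+ 3 / 2 * (12^-1 ^+ 3) `^ q^-1.
have c0 : 0 < c.
  apply: mulr_gt0; last by rewrite powR_gt0// exprn_gt0.
  by rewrite divr_gt0// exprn_gt0// mulr_gt0// pi_gt0.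
pose N : R := Num.sqrt ((pi / r) ^+ 3) `^ r^-1.
have N0 : 0 <= N by exact: powR_ge0.
(* S is T^{1/p} for T = S^p; it is chosen so that c S > C N. *)
pose S : R := C * N / c + 1.
have S0 : 0 < S.
  have : 0 <= C * N / c by exact: divr_ge0 (mulr_ge0 (ltW C0) N0) (ltW c0).
  by rewrite /S; lra.
have [eta eta0 lower] :=
  mixed_Lnorm_squeeze_ge b eps_gt0 F_gt1 p0 q0 (powR_gt0 p S0).
have apos := pos3_squeeze eta0.
have := est _ (in_Lp3_gauss3 r0 apos) _
  (is_propagation_gauss3 b eps F0 (lt0r_neq0 r0) apos).
move/(le_trans lower); rewrite Lnorm3_squeeze// -EFinM lee_fin -/c -/N.
rewrite -powRrM divff ?lt0r_neq0// powRr1 ?(ltW S0)// leNgt => /negP; apply.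
by rewrite /S mulrDr mulr1 [c * _]mulrC divfK ?lt0r_neq0// ltrDl.
Qed.
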